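(* For $d\geq 1$ let $k_d$ denote the supremum of the average degrees of the contact graphs of all finite packings of closed balls (of arbitrary, possibly different, positive radii) in $\mathbb{R}^d$. Then $$k_4<34.69 \quad\text{and}\quad k_5<77.76.$$
   Context: A packing of closed balls in $\mathbb{R}^d$ is a (nonempty) finite set of closed balls of positive radii with pairwise disjoint interiors; the radii need not be equal. The contact graph of a packing has the balls of the packing as vertices, two vertices being joined by an edge if and only if the corresponding balls are tangent. The average degree of a graph $G=(V,E)$ is $k(G)=2|E|/|V|$. Then $k_d=\sup_G k(G)$, where $G$ ranges over all contact graphs of packings of closed balls in $\mathbb{R}^d$. *)

(* Defs.v *)
From mathcomp Require Import all_boot all_order all_algebra.
From mathcomp Require Import all_classical reals constructive_ereal ereal.
From mathcomp Require Import topology normedtype.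

Set Implicit Arguments.
Unset Strict Implicit.
Unset Printing Implicit Defensive.

Import Order.TTheory GRing.Theory Num.Theory.
Import numFieldNormedType.Exports.

Local Open Scope classical_set_scope.
Local Open Scope ring_scope.

(* The canonical norm on 'rV[R]_d is the sup norm, so Euclidean distance and
   balls are defined here. The two norms induce the same topology, so the
   library's [interior] on 'rV[R]_d is the usual interior in R^d. *)
Definition eucl_dist (R : realType) (d : nat) (x y : 'rV[R]_d) : R :=
  Num.sqrt (\sum_(i < d) (x ord0 i - y ord0 i) ^+ 2).

Definition eucl_closed_ball (R : realType) (d : nat) (c : 'rV[R]_d) (r : R) :
  set 'rV[R]_d := [set x | eucl_dist c x <= r].

(* A finite family of balls indexed by 'I_n. For d >= 1 the balls have nonempty
   interiors, so disjointness makes the family injective and such families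
   amount to n-element sets of balls. *)
Definition is_packing (R : realType) (d n : nat)
    (c : 'I_n -> 'rV[R]_d) (r : 'I_n -> R) : Prop :=
  [/\ (0 < n)%N,
      forall i, 0 < r i
    & forall i j, i != j ->
        interior (eucl_closed_ball (c i) (r i)) `&`
        interior (eucl_closed_ball (c j) (r j)) = set0].

(* Meant for balls with disjoint interiors: they touch in exactly one point. *)
Definition tangent (R : realType) (d : nat) (A B : set 'rV[R]_d) : Prop :=
  exists x, A `&` B = [set x].

Definition contact_edges (R : realType) (d n : nat)
    (c : 'I_n -> 'rV[R]_d) (r : 'I_n -> R) : {set {set 'I_n}} :=
  [set E : {set 'I_n} | `[< exists i j : 'I_n,
     [/\ i != j,
         tangent (eucl_closed_ball (c i) (r i)) (eucl_closed_ball (c j) (r j))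
       & E = [set i; j]%SET ] >] ]%SET.

Definition average_degree (R : realType) (V : finType) (E : {set {set V}}) : R :=
  2 * #|E|%:R / #|V|%:R.

(* The supremum is taken in the extended reals: an upper bound on it includes
   the claim that the average degrees are bounded. *)
Definition sup_average_degree (R : realType) (d : nat) : \bar R :=
  ereal_sup [set k : \bar R | exists (n : nat)
      (c : 'I_n -> 'rV[R]_d) (r : 'I_n -> R),
    is_packing c r /\ k = (average_degree R (contact_edges c r))%:E].

(* Main.v *)
(** The argument of Kuperberg and Schramm, carried out in dimensions 4 and 5.
    Around ball i draw the concentric sphere of radius sqrt 3 * r_i. The
    interior of a ball j tangent to ball i cuts out of it a cap whose angular
    radius has cosine c_ij = (2 r_i + r_j) / (sqrt 3 (r_i + r_j)), and the caps
    belonging to the neighbours of i are disjoint, so their areas add up to at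
    most the area of the sphere. The relative area V(c) of a cap is a convex
    function of the cosine c, and c_ij + c_ji = sqrt 3 for all radii. Hence V can
    be replaced by its tangent at sqrt 3 / 2 = cos (pi / 6): summed over all
    ordered pairs of tangent balls, the linear terms cancel, and the average
    degree is at most 1 / V(sqrt 3 / 2), which is 34.680... for d = 4 and
    77.756... for d = 5.

    Areas of caps are measured as Lebesgue volumes of the cones over them inside
    the unit ball. Since a plane rotation is a product of shears, which preserve
    Lebesgue measure by Fubini's theorem, the joint distribution of <u, x> and
    |x|^2 is the same for all unit vectors u; this is the only form of rotation
    invariance needed. *)
Require Import Defs.
From HB Require Import structures.
From mathcomp Require Import all_boot all_order all_algebra.
From mathcomp Require Import all_classical reals constructive_ereal ereal.
From mathcomp Require Import all_analysis measurable_realfun.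
From mathcomp Require Import ring lra.

Set Implicit Arguments.
Unset Strict Implicit.
Unset Printing Implicit Defensive.

Import Order.TTheory GRing.Theory Num.Theory.
Import numFieldNormedType.Exports.

Local Open Scope classical_set_scope.
Local Open Scope ring_scope.

(** * Affine and orthogonal changes of variables *)

Section lebesgue_affine.
Context {R : realType}.
Local Notation mu := (@lebesgue_measure R).
Local Open Scope ereal_scope.
Implicit Type f : R -> \bar R.

Lemma ge0_integral_lebesgueN f : measurable_fun [set: R] f -> (forall x, 0 <= f x) ->
  \int[mu]_x f (- x)%R = \int[mu]_x f x.
Proof.
move=> mf f0.
rewrite -[LHS](@ge0_integral_pushforward _ _ _ _ _
  (-%R : measurableTypeR R -> measurableTypeR R) _ mu setT)//.
by apply: eq_measure_integral => //= A mA _; exact: lebesgue_measureN.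
Qed.

(** The image of Lebesgue measure under the translation still gives each half-open interval its
    length, and [lebesgue_measure_unique] then identifies the two measures. Scaling is treated in
    the same way below. *)
Lemma ge0_integral_lebesgueD f (a : R) : measurable_fun [set: R] f ->
  (forall x, 0 <= f x) -> \int[mu]_x f (x + a)%R = \int[mu]_x f x.
Proof.
move=> mf f0.
pose phi : measurableTypeR R -> measurableTypeR R := fun x => (x + a)%R.
have mphi : measurable_fun setT phi by exact: measurable_funD.
rewrite -[LHS](@ge0_integral_pushforward _ _ _ _ _ phi mphi mu setT)//.
apply: eq_measure_integral => //= A mA _.
apply/esym/lebesgue_measure_unique => //= _ [[p q]] _ <-.
rewrite /pushforward.
have -> : phi @^-1` `]p, q]%classic = `]p - a, q - a]%classic%R.
  by apply/seteqP; split => x /=; rewrite !in_itv /phi /=; lra.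
rewrite !lebesgue_measure_itv/= !lte_fin ltrD2r; case: ifP => // _.
by rewrite -!EFinD; congr EFin; lra.
Qed.

Lemma ge0_integral_lebesgueM f (r : R) : (0 < r)%R -> measurable_fun [set: R] f ->
  (forall x, 0 <= f x) -> r%:E * \int[mu]_x f (r * x)%R = \int[mu]_x f x.
Proof.
move=> r0 mf f0.
pose phi : measurableTypeR R -> measurableTypeR R := fun x => (r * x)%R.
have mphi : measurable_fun setT phi by exact: measurable_funM.
rewrite -[X in _ * X = _](@ge0_integral_pushforward _ _ _ _ _ phi mphi mu setT)//.
rewrite -(@ge0_integral_mscale _ _ _ (pushforward mu phi) setT measurableT
  (NngNum (ltW r0)))//.
apply: eq_measure_integral => //= A mA _.
apply/esym/lebesgue_measure_unique => //= _ [[p q]] _ <-.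
rewrite /mscale/= /pushforward.
have -> : phi @^-1` `]p, q]%classic = `]p / r, q / r]%classic%R.
  by apply/seteqP; split => x /=;
    rewrite !in_itv /phi /= ltr_pdivrMr// ler_pdivlMr// mulrC.
rewrite !lebesgue_measure_itv/= !lte_fin ltr_pM2r ?invr_gt0//.
case: ifP => // _; last by rewrite mule0.
by rewrite -!EFinD -EFinM; congr EFin; field; rewrite gt_eqF.
Qed.

End lebesgue_affine.

(** * Rotations of the plane as products of shears *)

Section plane_rotation.
Context {R : realType}.
Local Notation mu := (@lebesgue_measure R).
Local Open Scope ereal_scope.
Implicit Type f : R * R -> \bar R.

(** Written as an iterated integral, so that a shear of the second coordinate is just a translation
    inside the inner integral. *)
Local Definition iterint f := \int[mu]_x \int[mu]_y f (x, y).

Let shear_snd f (s : R) : measurable_fun [set: R * R] f -> (forall z, 0 <= f z) ->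
  iterint (fun z => f (z.1, z.2 + s * z.1)%R) = iterint f.
Proof.
move=> mf f0; apply: eq_integral => x _ /=.
rewrite (@ge0_integral_lebesgueD _ (fun y => f (x, y)))//.
by apply: measurableT_comp => //; exact: measurable_pair1.
Qed.

Let swp (z : R * R) : R * R := (z.2, z.1).

Let measurable_swp : measurable_fun setT swp.
Proof. exact/measurable_fun_pair. Qed.

Let iterint_swap f : measurable_fun [set: R * R] f -> (forall z, 0 <= f z) ->
  iterint f = iterint (f \o swp).
Proof. by move=> mf f0; rewrite /iterint fubini_tonelli. Qed.

(** Conjugation by the swap of coordinates, which Tonelli's theorem allows, reduces this to
    [shear_snd]. *)
Let shear_fst f (s : R) : measurable_fun [set: R * R] f -> (forall z, 0 <= f z) ->
  iterint (fun z => f (z.1 + s * z.2, z.2)%R) = iterint f.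
Proof.
move=> mf f0.
have mfs : measurable_fun [set: R * R] (f \o swp) by exact: measurableT_comp.
have e1 := @shear_snd (f \o swp) s mfs (fun z => f0 _).
rewrite (iterint_swap mf f0) -e1 iterint_swap//.
apply: (measurableT_comp mf); apply/measurable_fun_pair => //=.
by apply: measurable_funD => //; exact: measurable_funM.
Qed.

(* A rotation by an angle other than pi is a product of three shears. *)
Let rotation f (a b : R) : (a ^+ 2 + b ^+ 2 = 1)%R -> a != (-1)%R ->
  measurable_fun [set: R * R] f -> (forall z, 0 <= f z) ->
  iterint (fun z => f (a * z.1 + b * z.2, - b * z.1 + a * z.2)%R) = iterint f.
Proof.
move=> ab1 a1 mf f0.
have a10 : (1 + a != 0)%R by apply: contra_neq a1; lra.
(* For a = cos theta and b = sin theta this is tan (theta / 2); the three shears have coefficients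
   s, -b and s. *)
pose s := (b / (1 + a))%R.
have sb : (s * b = 1 - a)%R.
  have -> : (s * b = b ^+ 2 / (1 + a))%R by rewrite /s; field.
  have -> : (b ^+ 2 = 1 - a ^+ 2)%R by rewrite -ab1 addrC addKr.
  have -> : (1 - a ^+ 2 = (1 - a) * (1 + a))%R by ring.
  by rewrite mulfK.
have sa : (s * a = b - s)%R by rewrite /s; field.
pose f1 z := f (z.1 + s * z.2, z.2)%R.
pose f2 z := f1 (z.1, z.2 + - b * z.1)%R.
have mf1 : measurable_fun [set: R * R] f1.
  apply: (measurableT_comp mf); apply/measurable_fun_pair => //=.
  by apply: measurable_funD => //; exact: measurable_funM.
have mf2 : measurable_fun [set: R * R] f2.
  apply: (measurableT_comp mf1); apply/measurable_fun_pair => //=.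
  by apply: measurable_funD => //; exact: measurable_funM.
have f10 z : 0 <= f1 z by exact: f0.
have f20 z : 0 <= f2 z by exact: f0.
have e1 : iterint f1 = iterint f := shear_fst s mf f0.
have e2 : iterint f2 = iterint f1 := shear_snd (- b) mf1 f10.
have e3 : iterint (fun z => f2 (z.1 + s * z.2, z.2)%R) = iterint f2 :=
  shear_fst s mf2 f20.
rewrite -e1 -e2 -e3; congr (iterint _); apply/funext => -[x y].
rewrite /f2 /f1/=; congr (f (_, _)).
  have -> : (x + s * y + s * (y + - b * (x + s * y)) =
             x + s * y + s * y - (s * b) * (x + s * y))%R by ring.
  rewrite sb.
  have -> : (x + s * y + s * y - (1 - a) * (x + s * y) =
    a * x + s * y + s * a * y)%R by ring.
  by rewrite sa; ring.
have -> : (y + - b * (x + s * y) = y - b * x - (s * b) * y)%R by ring.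
by rewrite sb; ring.
Qed.

Lemma iterint_rotation (h : R * R -> \bar R) (a b : R) :
  (a ^+ 2 + b ^+ 2 = 1)%R -> measurable_fun [set: R * R] h -> (forall z, 0 <= h z) ->
  \int[mu]_x \int[mu]_y h (a * x + b * y, x ^+ 2 + y ^+ 2)%R =
  \int[mu]_x \int[mu]_y h (x, x ^+ 2 + y ^+ 2)%R.
Proof.
move=> ab1 mh h0.
pose g (h : R * R -> \bar R) z := h (z.1, z.1 ^+ 2 + z.2 ^+ 2)%R.
have rot a' b' (h' : R * R -> \bar R) : (a' ^+ 2 + b' ^+ 2 = 1)%R -> a' != (-1)%R ->
    measurable_fun [set: R * R] h' -> (forall z, 0 <= h' z) ->
    \int[mu]_x \int[mu]_y h' (a' * x + b' * y, x ^+ 2 + y ^+ 2)%R =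
    \int[mu]_x \int[mu]_y h' (x, x ^+ 2 + y ^+ 2)%R.
  move=> ab1' a1 mh' h0'.
  have mg : measurable_fun [set: R * R] (g h').
    apply: (measurableT_comp mh'); apply/measurable_fun_pair => //=.
    by apply: measurable_funD; exact: measurable_funX.
  apply: etrans (rotation ab1' a1 mg (fun z => h0' _)).
  apply: eq_integral => x _; apply: eq_integral => y _; rewrite /g/=.
  congr (h' (_, _)); rewrite -[LHS]mul1r -ab1'; ring.
have [a1|a1] := eqVneq a (-1)%R; last exact: rot.
have b0 : b = 0%R by apply/eqP; rewrite -sqrf_eq0; apply/eqP; move: ab1; rewrite a1; lra.
(* The remaining case is the half turn, done by two quarter turns: one takes the integral of [h']
   along x to that of [h] along y, the other takes the latter to the integral of [h] along x. *)
pose h' z := h (- z.1, z.2)%R.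
have mh' : measurable_fun [set: R * R] h'.
  by apply: (measurableT_comp mh); apply/measurable_fun_pair => //=;
    exact: measurableT_comp.
have r01 : (0 ^+ 2 + (-1) ^+ 2 = 1 :> R)%R by rewrite expr0n add0r sqrrN expr1n.
have r02 : (0 ^+ 2 + 1 ^+ 2 = 1 :> R)%R by rewrite expr0n add0r expr1n.
have n0 : 0%R != (-1)%R :> R by rewrite eq_sym oppr_eq0 oner_eq0.
transitivity (\int[mu]_x \int[mu]_y h' (x, x ^+ 2 + y ^+ 2)%R).
  apply: eq_integral => x _; apply: eq_integral => y _.
  by rewrite /h' a1 b0/= mulN1r mul0r addr0.
apply: etrans (esym (rot _ _ h' r01 n0 mh' (fun z => h0 _))) _.
apply: etrans (rot _ _ h r02 n0 mh h0).
apply: eq_integral => x _; apply: eq_integral => y _.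
by rewrite /h'/= !mul0r !add0r mulN1r opprK mul1r.
Qed.

End plane_rotation.

(** * Lebesgue measure on R^k *)

Definition dotv (R : realType) (k : nat) (u v : 'rV[R]_k) : R :=
  \sum_(i < k) u ord0 i * v ord0 i.

Section dotv_theory.
Context {R : realType}.

Lemma dotvv_ge0 k (u : 'rV[R]_k) : 0 <= dotv u u.
Proof. by apply: sumr_ge0 => i _; rewrite -expr2 sqr_ge0. Qed.

Lemma dotvZl k (a : R) (u v : 'rV[R]_k) : dotv (a *: u) v = a * dotv u v.
Proof. by rewrite mulr_sumr; apply: eq_bigr => i _; rewrite mxE mulrA. Qed.

Lemma dotvC k (u v : 'rV[R]_k) : dotv u v = dotv v u.
Proof. by apply: eq_bigr => i _; rewrite mulrC. Qed.

Lemma dotv0l_sqr0 k (u v : 'rV[R]_k) : dotv u u = 0 -> dotv u v = 0.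
Proof.
move=> /eqP; rewrite psumr_eq0 => [/allP u0|i _]; last by rewrite -expr2 sqr_ge0.
apply: big1 => i _; have := u0 i (mem_index_enum _).
by rewrite mulf_eq0 orbb => /eqP ->; rewrite mul0r.
Qed.

Definition consv k (x : R) (v : 'rV[R]_k) : 'rV[R]_k.+1 :=
  \row_i oapp (v ord0) x (unlift ord0 i).

Definition behead_rv k (u : 'rV[R]_k.+1) : 'rV[R]_k :=
  \row_i u ord0 (lift ord0 i).

Lemma dotv_consr k (u : 'rV[R]_k.+1) x v :
  dotv u (consv x v) = u ord0 ord0 * x + dotv (behead_rv u) v.
Proof.
rewrite /dotv big_ord_recl !mxE unlift_none/=; congr (_ + _).
by apply: eq_bigr => i _; rewrite !mxE liftK.
Qed.

Lemma dotvv_cons k x (v : 'rV[R]_k) : dotv (consv x v) (consv x v) = x ^+ 2 + dotv v v.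
Proof.
rewrite dotv_consr mxE unlift_none/= -expr2; congr (_ + _).
by apply: eq_bigr => i _; rewrite !mxE liftK.
Qed.

Lemma dotvv_behead k (u : 'rV[R]_k.+1) :
  dotv u u = u ord0 ord0 ^+ 2 + dotv (behead_rv u) (behead_rv u).
Proof.
rewrite /dotv big_ord_recl -expr2; congr (_ + _).
by apply: eq_bigr => i _; rewrite !mxE.
Qed.

End dotv_theory.

Section sliced.
Context {R : realType}.
Local Notation mu := (@lebesgue_measure R).
Local Open Scope ereal_scope.

(* For l = <u, x> with |u| = 1 and N = |x|^2 this expresses that rotating u to a
   coordinate axis does not change the joint distribution of l and N. *)
Definition sliced d (T : measurableType d) (nu : {measure set T -> \bar R})
    (l N : T -> R) : Prop :=
  exists (d' : measure_display) (T' : measurableType d')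
    (nu' : {sigma_finite_measure set T' -> \bar R}) (N' : T' -> R),
    measurable_fun setT N' /\
    forall h : R * R -> \bar R, measurable_fun [set: R * R] h -> (forall z, 0 <= h z) ->
      \int[nu]_t h (l t, N t) = \int[mu]_y \int[nu']_t h (y, y ^+ 2 + N' t)%R.

(** Slicing replaces l by a real coordinate y and an independent variable t in the orthogonal
    complement. For fixed t the pair (x, y) ranges over a plane, where [iterint_rotation] applies;
    Tonelli's theorem moves the integral over t outside. *)
Lemma sliced_rotation d (T : measurableType d) (nu : {measure set T -> \bar R})
    (l N : T -> R) (a b : R) (h : R * R -> \bar R) :
  sliced nu l N -> (a ^+ 2 + b ^+ 2 = 1)%R ->
  measurable_fun [set: R * R] h -> (forall z, 0 <= h z) ->
  \int[mu]_x \int[nu]_t h (a * x + b * l t, x ^+ 2 + N t)%R =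
  \int[mu]_x \int[nu]_t h (x, x ^+ 2 + N t)%R.
Proof.
move=> [d' [T' [nu' [N' [mN' sl]]]]] ab1 mh h0.
have mhg p q :
  measurable_fun [set: (R * T') * R] (fun z : (R * T') * R =>
    h (p * z.1.1 + q * z.2, z.1.1 ^+ 2 + (z.2 ^+ 2 + N' z.1.2))%R).
  apply: (measurableT_comp mh); apply/measurable_fun_pair => /=.
    apply: measurable_funD; apply: measurable_funM => //.
    exact: measurableT_comp.
  apply: measurable_funD; first by apply: measurable_funX; exact: measurableT_comp.
  apply: measurable_funD; first by apply: measurable_funX.
  by apply: (measurableT_comp mN'); exact: measurableT_comp.
have swp p q : \int[mu]_x \int[nu]_t h (p * x + q * l t, x ^+ 2 + N t)%R =
   \int[nu']_t \int[mu]_x \int[mu]_y h (p * x + q * y, x ^+ 2 + (y ^+ 2 + N' t))%R.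
  transitivity (\int[mu]_x \int[nu']_t \int[mu]_y
      h (p * x + q * y, x ^+ 2 + (y ^+ 2 + N' t))%R).
    apply: eq_integral => x _.
    rewrite (sl (fun z => h (p * x + q * z.1, x ^+ 2 + z.2)%R))//.
    - rewrite (@fubini_tonelli _ _ _ _ R mu nu'
        (fun z => h (p * x + q * z.1, x ^+ 2 + (z.1 ^+ 2 + N' z.2))%R))//.
      have mp : measurable_fun [set: R * T'] (fun z : R * T' => ((x, z.2), z.1)).
        by apply/measurable_fun_pair => //; apply/measurable_fun_pair.
      exact: (measurableT_comp (mhg p q) mp).
    - apply: (measurableT_comp mh); apply/measurable_fun_pair => /=.
        by apply: measurable_funD => //; exact: measurable_funM.
      exact: measurable_funD.
  rewrite (@fubini_tonelli _ _ _ _ R mu nu' (fun z => \int[mu]_y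
      h (p * z.1 + q * y, z.1 ^+ 2 + (y ^+ 2 + N' z.2))%R))//.
  - apply: (measurable_fun_fubini_tonelli_F (m2 := mu) _ (mhg p q)).
    by move=> z; exact: h0.
  - by move=> z; apply: integral_ge0 => y _; exact: h0.
(* The right-hand side is the case of coefficients 1 and 0, so that [swp] brings both sides to the
   same form. *)
rewrite swp; transitivity (\int[mu]_x \int[nu]_t h (1 * x + 0 * l t, x ^+ 2 + N t)%R).
  rewrite swp; apply: eq_integral => t _.
  pose ht (z : R * R) := h (z.1, z.2 + N' t)%R.
  have mht : measurable_fun [set: R * R] ht.
    apply: (measurableT_comp mh); apply/measurable_fun_pair => //=.
    exact: measurable_funD.
  have e a' b' : \int[mu]_x \int[mu]_y h (a' * x + b' * y, x ^+ 2 + (y ^+ 2 + N' t))%R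
      = \int[mu]_x \int[mu]_y ht (a' * x + b' * y, x ^+ 2 + y ^+ 2)%R.
    by apply: eq_integral => x _; apply: eq_integral => y _; rewrite /ht/= addrA.
  rewrite !e.
  apply: etrans (iterint_rotation ab1 mht (fun z => h0 _)) _.
  apply: eq_integral => x _; apply: eq_integral => y _.
  by rewrite mul1r mul0r addr0.
apply: eq_integral => x _; apply: eq_integral => t _.
by rewrite mul1r mul0r addr0.
Qed.

End sliced.

Section euclidean_model.
Context {R : realType}.
Local Notation mu := (@lebesgue_measure R).
Local Open Scope ereal_scope.

(* Lebesgue measure on R^k, carried by an arbitrary measurable type in place of
   'rV[R]_k so that it can be built as an iterated product measure. *)
Record euclidean_model (k : nat) := EuclideanModel {
  em_disp : measure_display;
  em_T : measurableType em_disp;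
  em_mu : {sigma_finite_measure set em_T -> \bar R};
  em_vec : em_T -> 'rV[R]_k;
  em_coord : forall i, measurable_fun setT (fun t => em_vec t ord0 i);
  em_scale : forall (r : R) (h : R -> \bar R), (0 < r)%R ->
    measurable_fun [set: R] h -> (forall x, 0 <= h x) ->
    (r ^+ k)%:E * \int[em_mu]_t h (r ^+ 2 * dotv (em_vec t) (em_vec t))%R =
    \int[em_mu]_t h (dotv (em_vec t) (em_vec t));
  em_ball_gt0 : 0 < em_mu [set t | dotv (em_vec t) (em_vec t) < 1]%R;
  em_ball_lty : em_mu [set t | dotv (em_vec t) (em_vec t) < 1]%R < +oo;
  em_sliced : forall u : 'rV[R]_k, dotv u u = 1%R ->
    sliced em_mu (fun t => dotv u (em_vec t)) (fun t => dotv (em_vec t) (em_vec t))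
}.

Lemma em_dotv k (M : euclidean_model k) (u : 'rV[R]_k) :
  measurable_fun setT (fun t => dotv u (em_vec (e := M) t)).
Proof.
apply: measurable_sum => i; apply: measurable_funM => //; exact: em_coord.
Qed.

Lemma em_normsq k (M : euclidean_model k) :
  measurable_fun setT (fun t => dotv (em_vec (e := M) t) (em_vec t)).
Proof.
by apply: measurable_sum => i; apply: measurable_funM => //; exact: em_coord.
Qed.

End euclidean_model.
Arguments euclidean_model : clear implicits.

Section sigma_finite_product.
Local Open Scope ereal_scope.
Context {R : realType} d1 d2 (T1 : measurableType d1) (T2 : measurableType d2).
Variable m1 : {sigma_finite_measure set T1 -> \bar R}.
Variable m2 : {sigma_finite_measure set T2 -> \bar R}.

Lemma sigma_finite_product : sigma_finite [set: T1 * T2] (m1 \x m2).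
Proof.
have /sigma_finiteP[F [TF ndF Foo]] := sigma_finiteT m1.
have /sigma_finiteP[G [TG ndG Goo]] := sigma_finiteT m2.
(* Both exhausting sequences increase, so the diagonal rectangles already cover the product. *)
exists (fun n => F n `*` G n) => [|n].
  apply/seteqP; split => // -[x y] _.
  have [i _ Fx] : (\bigcup_i F i) x by rewrite -TF.
  have [j _ Gy] : (\bigcup_i G i) y by rewrite -TG.
  exists (maxn i j) => //; split => /=.
    by have /subsetPset := ndF _ _ (leq_maxl i j); exact.
  by have /subsetPset := ndG _ _ (leq_maxr i j); exact.
have [[mF Fn] [mG Gn]] := (Foo n, Goo n).
split; first exact: measurableX.
by rewrite [ltLHS]product_measure1E// lte_mul_pinfty// ge0_fin_numE.
Qed.

Definition sigma_finite_prod : {sigma_finite_measure set (T1 * T2)%type -> \bar R} :=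
 HB.pack (m1 \x m2) (Measure_isSigmaFinite.Build _ _ _ (m1 \x m2) sigma_finite_product).

End sigma_finite_product.

Section euclidean_model0.
Context {R : realType}.
Local Open Scope ereal_scope.

(** R^0 is one point, given mass 1. It has no unit vectors, which makes [sliced0] vacuous. *)
Let vec0 (_ : unit) : 'rV[R]_0 := 0%R.
Let mu0 : {sigma_finite_measure set unit -> \bar R} := \d_tt.

Let normsq0 t : dotv (vec0 t) (vec0 t) = 0%R.
Proof. exact: big_ord0. Qed.

Let coord0 (i : 'I_0) : measurable_fun setT (fun t => vec0 t ord0 i).
Proof. by case: i. Qed.

Let scale0 (r : R) (h : R -> \bar R) : (0 < r)%R ->
  measurable_fun [set: R] h -> (forall x, 0 <= h x) ->
  (r ^+ 0)%:E * \int[mu0]_t h (r ^+ 2 * dotv (vec0 t) (vec0 t))%R =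
  \int[mu0]_t h (dotv (vec0 t) (vec0 t)).
Proof.
move=> _ _ _; rewrite expr0 mul1e; apply: eq_integral => t _.
by rewrite normsq0 mulr0.
Qed.

Let ball0 : [set t | dotv (vec0 t) (vec0 t) < 1]%R = setT.
Proof. by apply/seteqP; split => // t _ /=; rewrite normsq0. Qed.

Let ball0_gt0 : 0 < mu0 [set t | dotv (vec0 t) (vec0 t) < 1]%R.
Proof. by rewrite ball0 /mu0/= diracT. Qed.

Let ball0_lty : mu0 [set t | dotv (vec0 t) (vec0 t) < 1]%R < +oo.
Proof. by rewrite ball0 /mu0/= diracT ltry. Qed.

Let sliced0 (u : 'rV[R]_0) : dotv u u = 1%R ->
  sliced mu0 (fun t => dotv u (vec0 t)) (fun t => dotv (vec0 t) (vec0 t)).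
Proof. by rewrite /dotv big_ord0 => /esym/eqP; rewrite oner_eq0. Qed.

Definition euclidean_model0 : euclidean_model R 0 :=
  EuclideanModel coord0 scale0 ball0_gt0 ball0_lty sliced0.

End euclidean_model0.

Section euclidean_ball.
Context {R : realType} {k : nat} (M : euclidean_model R k).
Local Open Scope ereal_scope.

(** The parameter is the square of the radius. *)
Definition em_ball (r : R) : set (em_T M) :=
  [set t | dotv (em_vec t) (em_vec t) < r]%R.

Lemma measurable_em_ball r : measurable (em_ball r).
Proof.
rewrite (_ : em_ball r = (fun t => dotv (em_vec t) (em_vec t)) @^-1` `]-oo, r[).
  by rewrite -[X in measurable X]setTI; exact: em_normsq.
by apply/seteqP; split => t /=; rewrite in_itv.
Qed.

(** This is [em_scale] for the indicator function of the half-line below r^2. *)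
Lemma em_ballE (r : R) : (0 < r)%R ->
  em_mu M (em_ball (r ^+ 2)) = (r ^+ k)%:E * em_mu M (em_ball 1).
Proof.
move=> r0.
pose h (x : R) := (\1_(`]-oo, (r ^+ 2)%R[%classic) x : R)%:E.
have mh : measurable_fun [set: R] h.
  by apply/measurable_EFinP; exact: measurable_indic.
have h0 x : 0 <= h x by rewrite lee_fin.
have hE s y (t : em_T M) : (y < r ^+ 2)%R = (dotv (em_vec t) (em_vec t) < s)%R ->
    h y = (\1_(em_ball s) t : R)%:E.
  move=> e; rewrite /h !indicE.
  suff -> : (y \in `]-oo, (r ^+ 2)%R[%classic) = (t \in em_ball s) by [].
  by apply/idP/idP => /set_mem H; apply/mem_set; move: H; rewrite /em_ball/= in_itv/= e.
rewrite -[em_ball (r ^+ 2)]setIT -[em_ball 1]setIT.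
rewrite -(integral_indic (em_mu M) measurableT (measurable_em_ball (r ^+ 2))).
rewrite -(integral_indic (em_mu M) measurableT (measurable_em_ball 1)).
transitivity (\int[em_mu M]_t h (dotv (em_vec t) (em_vec t))).
  by apply: eq_integral => t _; rewrite (hE (r ^+ 2)%R _ t).
rewrite -(em_scale M r0 mh h0); congr (_ * _); apply: eq_integral => t _.
by apply: hE; rewrite gtr_pMr ?exprn_gt0.
Qed.

End euclidean_ball.

(** * From R^k to R^(k+1) *)

Section euclidean_modelS.
Context {R : realType} {k : nat} (M : euclidean_model R k).
Local Notation mu := (@lebesgue_measure R).
Local Notation nu := (em_mu M).
Local Open Scope ereal_scope.

Let T : measurableType _ := (measurableTypeR R * em_T M)%type.
Definition mu_cons : {sigma_finite_measure set T -> \bar R} :=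
  sigma_finite_prod mu nu.
Definition vec_cons (z : T) : 'rV[R]_k.+1 := consv z.1 (em_vec z.2).

Let N t := dotv (em_vec (e := M) t) (em_vec t).

Let normsqS z : dotv (vec_cons z) (vec_cons z) = (z.1 ^+ 2 + N z.2)%R.
Proof. exact: dotvv_cons. Qed.

Let coordS i : measurable_fun setT (fun z => vec_cons z ord0 i).
Proof.
under eq_fun do rewrite mxE.
case: unliftP => [j _|_]/=; last exact: measurable_fst.
apply: (measurableT_comp (em_coord (e := M) j)); exact: measurable_snd.
Qed.

(** Split u into its first coordinate a and the rest v. If v is nonzero, then v = b w with w a unit
    vector of R^k, and [sliced_rotation] for w turns a x + b <w, t> into x. If v = 0, then a is 1 or
    -1, and a reflection of the line suffices. *)
Lemma mu_cons_slice (u : 'rV[R]_k.+1) (h : R * R -> \bar R) : dotv u u = 1%R ->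
  measurable_fun [set: R * R] h -> (forall z, 0 <= h z) ->
  \int[mu_cons]_z h (dotv u (vec_cons z), dotv (vec_cons z) (vec_cons z)) =
  \int[mu]_x \int[nu]_t h (x, x ^+ 2 + dotv (em_vec t) (em_vec t))%R.
Proof.
move=> u1 mh h0.
pose a := u ord0 ord0; pose v := behead_rv u.
have mhu : measurable_fun [set: T] (fun z : T =>
    h (dotv u (vec_cons z), dotv (vec_cons z) (vec_cons z))).
  apply: (measurableT_comp mh); apply/measurable_fun_pair => /=.
    by apply: measurable_sum => i; apply: measurable_funM => //; exact: coordS.
  by apply: measurable_sum => i; apply: measurable_funM; exact: coordS.
apply: etrans (fubini_tonelli1 (m1 := mu) (m2 := nu) _ mhu (fun z => h0 _)) _.
transitivity (\int[mu]_x \int[nu]_t h (a * x + dotv v (em_vec t), x ^+ 2 + N t)%R).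
  by apply: eq_integral => x _; apply: eq_integral => t _; rewrite normsqS dotv_consr.
have av1 : (a ^+ 2 + dotv v v = 1)%R by rewrite -u1 dotvv_behead.
have [v0|v0] := eqVneq (dotv v v) 0%R; last first.
  pose b := Num.sqrt (dotv v v).
  have b2 : (b ^+ 2 = dotv v v)%R by rewrite sqr_sqrtr// dotvv_ge0.
  have b0 : b != 0%R by rewrite -sqrf_eq0 b2.
  pose w := (b^-1 *: v)%R.
  have w1 : dotv w w = 1%R.
    by rewrite /w dotvZl dotvC dotvZl -b2 expr2 mulKf// mulVf.
  have ab1 : (a ^+ 2 + b ^+ 2 = 1)%R by rewrite b2.
  apply: etrans _ (sliced_rotation (em_sliced M w1) ab1 mh h0).
  apply: eq_integral => x _; apply: eq_integral => t _.
  by rewrite /w dotvZl mulVKf.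
pose F (x : R) := \int[nu]_t h (x, x ^+ 2 + N t)%R.
have mF : measurable_fun [set: R] F.
  apply: (measurable_fun_fubini_tonelli_F (m2 := nu)
    (fun z : T => h (z.1, z.1 ^+ 2 + N z.2)%R)) => //.
  apply: (measurableT_comp mh); apply/measurable_fun_pair => //=.
  apply: measurable_funD; first exact: measurable_funX.
  exact: (measurableT_comp (em_normsq (M := M)) (@measurable_snd _ _ _ _)).
have F0 x : 0 <= F x by apply: integral_ge0 => t _; exact: h0.
transitivity (\int[mu]_x F (a * x)%R).
  apply: eq_integral => x _; apply: eq_integral => t _.
  have a2 : (a ^+ 2 = 1)%R by move: av1; rewrite v0 addr0.
  by rewrite dotv0l_sqr0// addr0 exprMn a2 mul1r.
have /eqP : (a ^+ 2 = 1)%R by move: av1; rewrite v0 addr0.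
rewrite sqrf_eq1 => /orP[] /eqP ->; first by apply: eq_integral => x _; rewrite mul1r.
apply: etrans (ge0_integral_lebesgueN mF F0).
by apply: eq_integral => x _; rewrite mulN1r.
Qed.

(** Slicing along the first basis vector, with a function that ignores its first argument. *)
Lemma mu_cons_normsq (h : R -> \bar R) : measurable_fun [set: R] h ->
  (forall x, 0 <= h x) ->
  \int[mu_cons]_z h (dotv (vec_cons z) (vec_cons z)) =
  \int[mu]_x \int[nu]_t h (x ^+ 2 + dotv (em_vec t) (em_vec t))%R.
Proof.
move=> mh h0; pose e : 'rV[R]_k.+1 := consv 1%R 0%R.
have e1 : dotv e e = 1%R.
  by rewrite dotvv_cons expr1n /dotv big1 ?addr0// => i _; rewrite mxE mul0r.
have mhs : measurable_fun [set: R * R] (h \o snd) by exact: measurableT_comp.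
exact: (mu_cons_slice e1 mhs (fun z => h0 _)).
Qed.

(** One factor r comes from scaling the first coordinate, the other r^k from [em_scale] on the
    slices. *)
Let scaleS (r : R) (h : R -> \bar R) : (0 < r)%R ->
  measurable_fun [set: R] h -> (forall x, 0 <= h x) ->
  (r ^+ k.+1)%:E * \int[mu_cons]_t h (r ^+ 2 * dotv (vec_cons t) (vec_cons t))%R =
  \int[mu_cons]_t h (dotv (vec_cons t) (vec_cons t)).
Proof.
move=> r0 mh h0.
have mhr : measurable_fun [set: R] (fun y => h (r ^+ 2 * y)%R).
  by apply: (measurableT_comp mh); exact: measurable_funM.
rewrite (mu_cons_normsq mhr (fun y => h0 _)) (mu_cons_normsq mh h0).
pose F (x : R) := \int[nu]_t h (x ^+ 2 + N t)%R.
have mhN (c : R) : measurable_fun [set: R] (fun x => h (c ^+ 2 + x)%R).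
  by apply: (measurableT_comp mh); exact: measurable_funD.
have mF : measurable_fun [set: R] F.
  apply: (measurable_fun_fubini_tonelli_F (m2 := nu)
    (fun z : T => h (z.1 ^+ 2 + N z.2)%R)) => //.
  apply: (measurableT_comp mh).
  apply: measurable_funD; first exact: measurable_funX.
  exact: (measurableT_comp (em_normsq (M := M)) (@measurable_snd _ _ _ _)).
have F0 x : 0 <= F x by apply: integral_ge0 => t _; exact: h0.
have mFr : measurable_fun [set: R] (fun x => F (r * x)%R).
  by apply: (measurableT_comp mF); exact: measurable_funM.
rewrite -[RHS](ge0_integral_lebesgueM r0 mF F0) exprS EFinM -muleA; congr (_ * _).
transitivity (\int[mu]_x ((r ^+ k)%:E *
    \int[nu]_t h (r ^+ 2 * (x ^+ 2 + N t))%R)).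
  rewrite ge0_integralZl //=.
  - apply: (measurable_fun_fubini_tonelli_F (m2 := nu)
      (fun z : T => h (r ^+ 2 * (z.1 ^+ 2 + N z.2))%R)) => //.
    apply: (measurableT_comp mh); apply: measurable_funM => //.
    apply: measurable_funD; first exact: measurable_funX.
    exact: (measurableT_comp (em_normsq (M := M)) (@measurable_snd _ _ _ _)).
  - by move=> x _; apply: integral_ge0 => t _; exact: h0.
  - by rewrite lee_fin exprn_ge0// ltW.
apply: eq_integral => x _; rewrite /F.
rewrite -(em_scale M r0 (mhN (r * x)%R) (fun y => h0 _)); congr (_ * _).
by apply: eq_integral => t _; rewrite mulrDr exprMn.
Qed.

Let ballS r : set T := [set z | dotv (vec_cons z) (vec_cons z) < r]%R.

Let measurable_ballS r : measurable (ballS r).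
Proof.
rewrite (_ : ballS r = (fun z => dotv (vec_cons z) (vec_cons z)) @^-1` `]-oo, r[).
  rewrite -[X in measurable X]setTI.
  have : measurable_fun [set: T] (fun z => dotv (vec_cons z) (vec_cons z)).
    by apply: measurable_sum => i; apply: measurable_funM; exact: coordS.
  exact.
by apply/seteqP; split => t /=; rewrite in_itv.
Qed.

Let mu_consX (a b s : R) : mu_cons (`]a, b[ `*` em_ball (M := M) s) =
  mu `]a, b[%classic * nu (em_ball s).
Proof. by rewrite [LHS]product_measure1E//; exact: measurable_em_ball. Qed.

Let measurable_box (a b s : R) :
  measurable (`]a, b[%classic `*` em_ball (M := M) s : set T).
Proof. by apply: measurableX; [exact: measurable_itv|exact: measurable_em_ball]. Qed.

(** The unit ball contains the product of an interval and a ball, both of radius 1/2; for finiteness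
    below it is enclosed in such a product with radii 1. *)
Let ballS_gt0 : 0 < mu_cons (ballS 1%R).
Proof.
have h0 : (0 < 2^-1 :> R)%R by [].
have : 0 < mu_cons (`](- 2^-1)%R, 2^-1%R[ `*` em_ball (M := M) (2^-1 ^+ 2)%R).
  rewrite mu_consX em_ballE// lebesgue_measure_itv/= lte_fin gtrN//.
  apply: mule_gt0; first by rewrite lte_fin; lra.
  by apply: mule_gt0; [rewrite lte_fin exprn_gt0|exact: em_ball_gt0].
move/lt_le_trans; apply.
apply: le_measure;
  [by rewrite inE; exact: measurable_box|by rewrite inE; exact: measurable_ballS|].
move=> [x t] []/=; rewrite in_itv/= => /andP[x1 x2] t1.
rewrite /ballS/= normsqS/=; move: t1; rewrite /em_ball/= -/(N t).
have : (0 < (2^-1 - x) * (x + 2^-1))%R by rewrite mulr_gt0//; lra.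
lra.
Qed.

Let ballS_lty : mu_cons (ballS 1%R) < +oo.
Proof.
have : mu_cons (`](-1)%R, 1%R[ `*` em_ball (M := M) 1%R) < +oo.
  rewrite mu_consX lebesgue_measure_itv/= lte_fin gtrN//.
  by apply: lte_mul_pinfty; [rewrite lee_fin; lra| |exact: em_ball_lty].
apply: le_lt_trans.
apply: le_measure;
  [by rewrite inE; exact: measurable_ballS|by rewrite inE; exact: measurable_box|].
move=> [x t]; rewrite /ballS/= normsqS/= => xt.
have t0 : (0 <= N t)%R by exact: dotvv_ge0.
by split => /=; [rewrite in_itv/=; nra|rewrite /em_ball/= -/(N t); nra].
Qed.

Let slicedS (u : 'rV[R]_k.+1) : dotv u u = 1%R ->
  sliced mu_cons (fun z => dotv u (vec_cons z)) (fun z => dotv (vec_cons z) (vec_cons z)).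
Proof.
move=> u1; exists _, (em_T M), nu, N; split; first exact: em_normsq.
by move=> h mh h0; exact: mu_cons_slice.
Qed.

Definition euclidean_modelS : euclidean_model R k.+1 :=
  EuclideanModel coordS scaleS ballS_gt0 ballS_lty slicedS.

End euclidean_modelS.

Fixpoint euclidean_space (R : realType) (k : nat) : euclidean_model R k :=
  if k is k'.+1 then euclidean_modelS (euclidean_space R k') else euclidean_model0.

(** * Volumes of cones *)

Section cone.
Context {R : realType} {k : nat}.
Local Notation mu := (@lebesgue_measure R).
Local Notation M := (euclidean_space R k).
Local Notation MS := (euclidean_space R k.+1).
Local Open Scope ereal_scope.

Definition unit_ball_vol (j : nat) : R :=
  fine (em_mu (euclidean_space R j) (em_ball (M := euclidean_space R j) 1%R)).

Lemma unit_ball_volE j : em_mu (euclidean_space R j) (em_ball 1%R) = (unit_ball_vol j)%:E.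
Proof.
rewrite /unit_ball_vol fineK// ge0_fin_numE//; exact: em_ball_lty.
Qed.

Lemma unit_ball_vol_gt0 j : (0 < unit_ball_vol j)%R.
Proof. by rewrite -lte_fin -unit_ball_volE; exact: em_ball_gt0. Qed.

(** For a unit vector u and c >= 0: the points of the open unit ball whose angle with u has cosine
    greater than c. Membership depends only on the pair (<u, z>, |z|^2), as [mu_cons_slice]
    requires. *)
Definition cone (u : 'rV[R]_k.+1) (c : R) : set (em_T MS) :=
  [set z | [/\ 0 < dotv u (em_vec z),
    c ^+ 2 * dotv (em_vec z) (em_vec z) < dotv u (em_vec z) ^+ 2 &
    dotv (em_vec z) (em_vec z) < 1]%R].

Let coneset (c : R) : set (R * R) :=
  [set z | [/\ 0 < z.1, c ^+ 2 * z.2 < z.1 ^+ 2 & z.2 < 1]%R].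

Let measurable_coneset c : measurable (coneset c).
Proof.
rewrite (_ : coneset c = fst @^-1` `]0%R, +oo[ `&`
  ((fun z => z.1 ^+ 2 - c ^+ 2 * z.2)%R @^-1` `]0%R, +oo[ `&` snd @^-1` `]-oo, 1%R[)).
  apply: measurableI; [|apply: measurableI].
  - by rewrite -[X in measurable X]setTI; exact: measurable_fst.
  - rewrite -[X in measurable X]setTI.
    have : measurable_fun [set: R * R] (fun z => z.1 ^+ 2 - c ^+ 2 * z.2)%R.
      by apply: measurable_funB; [exact: measurable_funX|exact: measurable_funM].
    exact.
  - by rewrite -[X in measurable X]setTI; exact: measurable_snd.
apply/seteqP; split => z /=; rewrite !in_itv/= !andbT subr_gt0.
  by case=> *; split.
by case=> ? [].
Qed.

Let pairm (u : 'rV[R]_k.+1) : measurable_fun [set: em_T MS]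
  (fun z => (dotv u (em_vec z), dotv (em_vec z) (em_vec z))).
Proof. by apply/measurable_fun_pair; [exact: em_dotv|exact: em_normsq]. Qed.

Lemma measurable_cone u c : measurable (cone u c).
Proof.
have := pairm u measurableT (measurable_coneset c); rewrite setTI; exact.
Qed.

Lemma cone_volE u c : dotv u u = 1%R -> em_mu MS (cone u c) =
  \int[mu]_x em_mu M [set t | coneset c (x, x ^+ 2 + dotv (em_vec t) (em_vec t))%R].
Proof.
move=> u1; pose h (z : R * R) := (\1_(coneset c) z : R)%:E.
have mh : measurable_fun [set: R * R] h.
  by apply/measurable_EFinP; exact: measurable_indic.
have h0 z : 0 <= h z by rewrite lee_fin.
have := mu_cons_slice M u1 mh h0.
rewrite -[cone u c]setIT -integral_indic//; last exact: measurable_cone.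
move=> e; apply: etrans e _; apply: eq_integral => x _.
have mx : measurable_fun [set: em_T M]
    (fun t => (x, x ^+ 2 + dotv (em_vec t) (em_vec t)))%R.
  apply/measurable_fun_pair => //; apply: measurable_funD => //; exact: em_normsq.
have mS : measurable
    [set t : em_T M | coneset c (x, x ^+ 2 + dotv (em_vec t) (em_vec t))%R].
  by have := mx measurableT _ (measurable_coneset c); rewrite setTI; exact.
by rewrite -[in RHS](setIT [set t | _]) -integral_indic.
Qed.

Let N (t : em_T M) := dotv (em_vec t) (em_vec t).

Let measurable_slice (S : set (R * R)) : measurable S ->
  measurable_fun [set: R] (fun x => em_mu M [set t | S (x, x ^+ 2 + N t)%R]).
Proof.
move=> mS; pose h (z : measurableTypeR R * em_T M) : \bar R :=
  (\1_S (z.1, z.1 ^+ 2 + N z.2)%R : R)%:E.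
have mh : measurable_fun setT h.
  have mi : measurable_fun [set: R * R] (\1_S : R * R -> R) by exact: measurable_indic.
  have mp : measurable_fun [set: measurableTypeR R * em_T M]
      (fun z => (z.1, z.1 ^+ 2 + N z.2)%R).
    apply/measurable_fun_pair => //; apply: measurable_funD.
      exact: measurable_funX.
    exact: (measurableT_comp (em_normsq (M := M)) measurable_snd).
  by apply/measurable_EFinP; exact: (measurableT_comp mi mp).
have h0 z : 0 <= h z by rewrite lee_fin.
have := measurable_fun_fubini_tonelli_F (m2 := em_mu M) h mh h0.
apply: eq_measurable_fun => x _; rewrite /fubini_F.
have mx : measurable_fun [set: em_T M] (fun t => (x, x ^+ 2 + N t))%R.
  apply/measurable_fun_pair => //; apply: measurable_funD => //; exact: em_normsq.
have mSx : measurable [set t : em_T M | S (x, x ^+ 2 + N t)%R].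
  by have := mx measurableT _ mS; rewrite setTI; exact.
by rewrite -[in RHS](setIT [set t | _]) -integral_indic.
Qed.

Lemma ball_volE : (0 < k)%N -> em_mu MS (em_ball 1%R) =
  \int[mu]_(x in `[(-1)%R, 1%R]) (unit_ball_vol k * Num.sqrt (1 - x ^+ 2) ^+ k)%:E.
Proof.
move=> k0; pose f (x : R) := (unit_ball_vol k * Num.sqrt (1 - x ^+ 2) ^+ k)%R.
(* [Num.sqrt] is 0 at negative numbers, and 0^k = 0 because k > 0. *)
have f0 x : x \notin `[(-1)%R, 1%R] -> f x = 0%R.
  rewrite in_itv/= negb_and -!ltNge => x1.
  rewrite /f ler0_sqrtr ?expr0n ?gtn_eqF ?mulr0//.
  by case/orP: x1 => x1; nra.
transitivity (\int[mu]_x (f x)%:E); last first.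
  rewrite [RHS]integral_mkcond; apply: eq_integral => x _.
  rewrite patchE; case: ifPn => // xn; rewrite f0//.
  by apply: contra xn => xi; apply/mem_set.
pose h (x : R) := (\1_(`]-oo, 1%R[%classic) x : R)%:E.
have mh : measurable_fun [set: R] h.
  by apply/measurable_EFinP; exact: measurable_indic.
have h0 x : 0 <= h x by rewrite lee_fin.
rewrite -[em_ball _]setIT -integral_indic//; last exact: measurable_em_ball.
transitivity (\int[em_mu MS]_z h (dotv (em_vec z) (em_vec z))).
  apply: eq_integral => z _; rewrite /h !indicE.
  suff -> : (z \in em_ball 1%R) =
    (dotv (em_vec z) (em_vec z) \in `]-oo, 1%R[%classic) by [].
  by apply/idP/idP => /set_mem H; apply/mem_set; move: H;
    rewrite /em_ball/= in_itv/=.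
apply: etrans (mu_cons_normsq M mh h0) _; apply: eq_integral => x _.
transitivity (em_mu M (em_ball (1 - x ^+ 2)%R)).
  rewrite -[em_ball _]setIT -integral_indic//; last exact: measurable_em_ball.
  apply: eq_integral => t _; rewrite /h !indicE.
  suff -> : (t \in em_ball (1 - x ^+ 2)%R) =
    ((x ^+ 2 + dotv (em_vec t) (em_vec t))%R \in `]-oo, 1%R[%classic) by [].
  by apply/idP/idP => /set_mem H; apply/mem_set; move: H;
    rewrite /em_ball/= in_itv/= ltrBrDl.
have [x1|x1] := ltP 0%R (1 - x ^+ 2)%R.
  rewrite -[in LHS](@sqr_sqrtr _ (1 - x ^+ 2)%R) ?ltW//.
  by rewrite em_ballE ?sqrtr_gt0// unit_ball_volE -EFinM /f mulrC.
rewrite /f ler0_sqrtr// expr0n gtn_eqF// mulr0.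
rewrite (_ : em_ball _ = set0) ?measure0//; apply/seteqP; split => // t.
by rewrite /em_ball/= => /(le_lt_trans (dotvv_ge0 _)); rewrite ltNge x1.
Qed.

(** Cut the cone orthogonally to u at height x. Up to height c the slice contains a ball whose
    radius is x times the tangent of the opening angle; beyond c it contains the whole slice of the
    unit ball. *)
Lemma cone_vol_ge (u : 'rV[R]_k.+1) (c : R) : (0 < k)%N ->
  dotv u u = 1%R -> (0 < c < 1)%R ->
  (\int[mu]_(x in `[0%R, c]) (unit_ball_vol k * (x * (Num.sqrt (1 - c ^+ 2) / c)) ^+ k)%:E +
   \int[mu]_(x in `]c, 1%R]) (unit_ball_vol k * Num.sqrt (1 - x ^+ 2) ^+ k)%:E <=
   em_mu MS (cone u c))%E.
Proof.
move=> k0 u1 /andP[c0 c1]; rewrite cone_volE//.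
pose s x := em_mu M [set t | coneset c (x, x ^+ 2 + N t)%R].
have ms : measurable_fun [set: R] s by exact: measurable_slice.
have s0 x : 0 <= s x by exact: measure_ge0.
(* The balls of the slices are open, so non-strict conditions on r suffice. The premise on x admits
   the apex x = 0, where r = 0. *)
have slice_ge x r : (0 <= r)%R -> (0 < r -> 0 < x)%R -> (c ^+ 2 * (x ^+ 2 + r ^+ 2) <= x ^+ 2)%R ->
    (x ^+ 2 + r ^+ 2 <= 1)%R -> (unit_ball_vol k * r ^+ k)%:E <= s x.
  rewrite le_eqVlt => /predU1P[<- _ _ _|r0 /(_ r0) x0 xr1 xr2].
    by rewrite expr0n gtn_eqF// mulr0; exact: s0.
  rewrite EFinM muleC -unit_ball_volE -em_ballE//; apply: le_measure; rewrite ?inE.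
  - exact: measurable_em_ball.
  - have mx : measurable_fun [set: em_T M] (fun t => (x, x ^+ 2 + N t))%R.
      by apply/measurable_fun_pair => //; apply: measurable_funD => //; exact: em_normsq.
    by have := mx measurableT _ (measurable_coneset c); rewrite setTI; exact.
  - move=> t; rewrite /em_ball/= -/(N t) => Nt.
    have c20 : (0 < c ^+ 2)%R by exact: exprn_gt0.
    split => //=; last by apply: lt_le_trans xr2; rewrite ltrD2l.
    by apply: lt_le_trans xr1; rewrite ltr_pM2l// ltrD2l.
have disj : [disjoint `[0%R, c]%classic & `]c, 1%R]%classic].
  apply/disj_setPS => x [] /=; rewrite !in_itv/= => /andP[_ xc] /andP[cx _].
  by move: (le_lt_trans xc cx); rewrite ltxx.
apply: (@le_trans _ _ (\int[mu]_(x in `[0%R, c] `|` `]c, 1%R]) s x)); last first.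
  by apply: ge0_subset_integral => //; exact: measurableU.
rewrite ge0_integral_setU//; last exact: measurable_funTS.
have c2 : (c ^+ 2 < 1)%R by rewrite expr_lt1// ltW.
have sc : (Num.sqrt (1 - c ^+ 2) ^+ 2 = 1 - c ^+ 2)%R by rewrite sqr_sqrtr// subr_ge0 ltW.
have msqrt : measurable_fun [set: R] (fun x : R => Num.sqrt (1 - x ^+ 2) ^+ k)%R.
  apply: measurable_funX.
  have ms1 : measurable_fun [set: R] (@Num.sqrt R).
    by apply: continuous_measurable_fun; exact: sqrt_continuous.
  by apply: (measurableT_comp ms1); apply: measurable_funB => //; exact: measurable_funX.
have mlin : measurable_fun [set: R] (fun x : R => (x * (Num.sqrt (1 - c ^+ 2) / c)) ^+ k)%R.
  by apply: measurable_funX; exact: measurable_funM.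
have kp := unit_ball_vol_gt0 k.
apply: leeD.
- apply: ge0_le_integral => //.
  + move=> x /=; rewrite in_itv/= => /andP[x0 xc]; rewrite lee_fin.
    by rewrite mulr_ge0 ?(ltW kp)// exprn_ge0// mulr_ge0// divr_ge0 ?sqrtr_ge0// ltW.
  + apply/measurable_EFinP; apply: measurable_funM => //; exact: measurable_funTS.
  + exact: measurable_funTS.
  + move=> x /=; rewrite in_itv/= => /andP[x0 xc]; apply: slice_ge.
    * by rewrite mulr_ge0// divr_ge0 ?sqrtr_ge0// ltW.
    * move=> r0; rewrite lt_neqAle x0 andbT; apply: contraTneq r0 => <-.
      by rewrite mul0r ltxx.
    * rewrite exprMn expr_div_n sc.
      suff -> : (c ^+ 2 * (x ^+ 2 + x ^+ 2 * ((1 - c ^+ 2) / c ^+ 2)) = x ^+ 2)%R by [].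
      by field; rewrite gt_eqF.
    * rewrite exprMn expr_div_n sc.
      have -> : (x ^+ 2 + x ^+ 2 * ((1 - c ^+ 2) / c ^+ 2) = (x / c) ^+ 2)%R.
        by field; rewrite gt_eqF.
      by rewrite expr_le1// ?ler_pdivrMr ?mul1r// divr_ge0// ltW.
- apply: ge0_le_integral => //.
  + by move=> x _; rewrite lee_fin mulr_ge0 ?(ltW kp)// exprn_ge0// sqrtr_ge0.
  + apply/measurable_EFinP; apply: measurable_funM => //; exact: measurable_funTS.
  + exact: measurable_funTS.
  + move=> x /=; rewrite in_itv/= => /andP[cx x1].
    have x0 : (0 < x)%R by exact: lt_trans cx.
    have x21 : (x ^+ 2 <= 1)%R by rewrite expr_le1// ltW.
    have sx : (Num.sqrt (1 - x ^+ 2) ^+ 2 = 1 - x ^+ 2)%R by rewrite sqr_sqrtr// subr_ge0.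
    apply: slice_ge => //; rewrite ?sqrtr_ge0// sx addrC subrK//.
    by rewrite mulr1 ler_sqr ?nnegrE ltW.
Qed.
End cone.

(** * Cone volumes from a primitive of (1 - x^2)^(k/2) *)

Section primitive.
Context {R : realType}.
Local Notation mu := (@lebesgue_measure R).

Lemma integral_primitive (f F : R -> R) (a b : R) : a < b ->
  {within `[a, b], continuous f} -> {within `[a, b], continuous F} ->
  (forall x, a < x < b -> is_derive x 1 F (f x)) ->
  (\int[mu]_(x in `[a, b]) (f x)%:E = (F b - F a)%:E)%E.
Proof.
move=> ab cf cF dF; rewrite EFinB; apply: continuous_FTC2 => //.
- have [_ Fa Fb] := (continuous_within_itvP F ab).1 cF.
  by split => // x; rewrite in_itv/= => /dF dFx; exact: ex_derive.
- by move=> x; rewrite in_itv/= => /dF dFx; rewrite derive1E; exact: derive_val.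
Qed.

Lemma continuous_sqrt1Bsqr k : continuous (fun x : R => Num.sqrt (1 - x ^+ 2) ^+ k).
Proof.
move=> x; apply: (@continuous_comp _ _ _
  (fun x : R => Num.sqrt (1 - x ^+ 2)) (fun y : R => y ^+ k)).
  apply: (@continuous_comp _ _ _ (fun x : R => 1 - x ^+ 2) Num.sqrt).
    by apply: cvgB; [exact: cvg_cst|exact: exprn_continuous].
  exact: sqrt_continuous.
exact: exprn_continuous.
Qed.

Lemma integral_monomial (a c : R) (k : nat) : 0 < c ->
  (\int[mu]_(x in `[0%R, c]) ((x * a) ^+ k)%:E = (a ^+ k * c ^+ k.+1 / k.+1%:R)%:E)%E.
Proof.
move=> c0.
pose p : {poly R} := (a ^+ k / k.+1%:R) *: 'X^(k.+1).
have pE x : p.[x] = a ^+ k * x ^+ k.+1 / k.+1%:R.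
  by rewrite !hornerE mulrAC.
have d (x : R) : is_derive x 1 (horner p) ((x * a) ^+ k).
  apply: is_derive_eq (is_derive_poly p x) _.
  rewrite derivZ derivXn !hornerE hornerMn hornerXn exprMn -mulr_natl.
  by field; rewrite addrC natr1 pnatr_eq0.
rewrite (integral_primitive c0 _ _ (fun x _ => d x)).
- by rewrite !pE expr0n mulr0 mul0r subr0.
- apply: continuous_subspaceT => x.
  apply: (@continuous_comp _ _ _ (fun x : R => x * a) (fun y : R => y ^+ k)).
    exact: mulrr_continuous.
  exact: exprn_continuous.
- by apply: continuous_subspaceT; exact: continuous_horner.
Qed.

End primitive.

Section cone_primitive.
Context {R : realType} {k : nat}.
Local Notation mu := (@lebesgue_measure R).
Variable P : R -> R.
Hypothesis k0 : (0 < k)%N.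
Hypothesis cP : {within `[(-1), 1], continuous P}.
Hypothesis dP : forall x : R, -1 < x < 1 -> is_derive x 1 P (Num.sqrt (1 - x ^+ 2) ^+ k).

Lemma ball_vol_primitive :
  em_mu (euclidean_space R k.+1) (em_ball 1) =
  (unit_ball_vol k * (P 1 - P (-1)))%:E.
Proof.
have n11 : -1 < 1 :> R by lra.
have cs : {within `[(-1)%R, 1%R], continuous (fun x : R => Num.sqrt (1 - x ^+ 2) ^+ k)}.
  by apply: continuous_subspaceT; exact: continuous_sqrt1Bsqr.
rewrite ball_volE// EFinM.
rewrite -(integral_primitive n11 cs cP dP).
transitivity (\int[mu]_(x in `[(-1)%R, 1%R])
    ((unit_ball_vol k)%:E * (Num.sqrt (1 - x ^+ 2) ^+ k)%:E))%E.
  by apply: eq_integral => x _; rewrite EFinM.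
rewrite ge0_integralZl_EFin//.
- apply/measurable_EFinP/measurable_funTS; apply: continuous_measurable_fun.
  exact: continuous_sqrt1Bsqr.
- by rewrite ltW// unit_ball_vol_gt0.
Qed.

(** The first summand is the straight cone of height c over a ball of radius sqrt (1 - c^2);
    [P 1 - P c] is the part of the unit ball beyond height c. *)
Lemma cone_vol_primitive (u : 'rV[R]_k.+1) (c : R) : dotv u u = 1 -> 0 < c < 1 ->
  ((unit_ball_vol k * (Num.sqrt (1 - c ^+ 2) ^+ k * c / k.+1%:R + P 1 - P c))%:E <=
   em_mu (euclidean_space R k.+1) (cone u c))%E.
Proof.
move=> u1 /[dup] c01 /andP[c0 c1]; apply: le_trans (cone_vol_ge k0 u1 c01).
pose s (x : R) := Num.sqrt (1 - x ^+ 2) ^+ k; pose t := Num.sqrt (1 - c ^+ 2) / c.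
have ms (D : set R) : measurable_fun D (fun x => (s x)%:E).
  apply/measurable_EFinP/measurable_funTS; apply: continuous_measurable_fun.
  exact: continuous_sqrt1Bsqr.
have ml (D : set R) : measurable_fun D (fun x => ((x * t) ^+ k)%:E).
  apply/measurable_EFinP/measurable_funTS; apply: measurable_funX.
  exact: measurable_funM.
have s0 x : (0 <= (s x)%:E)%E by rewrite lee_fin exprn_ge0// sqrtr_ge0.
have kp : 0 <= unit_ball_vol k :> R by exact: ltW (unit_ball_vol_gt0 k).
have cs : {within `[c, 1%R], continuous s}.
  by apply: continuous_subspaceT; exact: continuous_sqrt1Bsqr.
have cPc : {within `[c, 1%R], continuous P}.
  apply: continuous_subspaceW cP => x /=; rewrite !in_itv/= => /andP[cx ->].
  by rewrite andbT (le_trans _ cx)//; lra.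
have dPc x : c < x < 1 -> is_derive x 1 P (s x).
  by move=> /andP[cx x1]; apply: dP; rewrite x1 andbT (lt_trans _ cx)//; lra.
under [X in (X + _)%E]eq_integral do rewrite EFinM.
rewrite ge0_integralZl_EFin//; first last.
- exact: ml.
- move=> x; rewrite /= in_itv/= => /andP[x0 _].
  rewrite lee_fin; apply: exprn_ge0; apply: mulr_ge0 => //; apply: divr_ge0.
    exact: sqrtr_ge0.
  exact: ltW.
rewrite integral_monomial//.
under [X in (_ + X)%E]eq_integral do rewrite EFinM.
rewrite ge0_integralZl_EFin//; last exact: ms.
rewrite integral_itv_obnd_cbnd; last exact: ms.
rewrite (integral_primitive c1 cs cPc dPc) -!EFinM -EFinD lee_fin -mulrDr.
apply: ler_wpM2l => //; rewrite addrA -subr_ge0.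
suff -> : Num.sqrt (1 - c ^+ 2) ^+ k * c =
    (Num.sqrt (1 - c ^+ 2) / c) ^+ k * c ^+ k.+1 by rewrite subrr.
by rewrite expr_div_n (exprSr c k) mulrA mulfVK// expf_neq0// gt_eqF.
Qed.

End cone_primitive.

(** * Arccosine, a tangent line inequality and a lower bound for pi *)

Section trigonometry.
Context {R : realType}.
Local Notation pi := (@pi R).

Let lt_cos (x y : R) : 0 <= x <= pi -> 0 <= y <= pi -> (cos x < cos y) = (y < x).
Proof. by move=> xb yb; rewrite ltr_cos// in_itv. Qed.

Lemma acos_within_continuous : {within `[(-1)%R, 1%R], continuous (@acos R)}.
Proof.
have n11 : -1 < 1 :> R by lra.
have pi0 := @pi_gt0 R.
apply/(continuous_within_itvP _ n11); split.
- by move=> x; rewrite in_itv/=; exact: continuous_acos.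
- rewrite acosN1; apply/cvgrPdist_lt => e e0.
  (* This d is less than both e and pi, so pi - d lies in [0, pi], where cos decreases and bounds on
     [acos x] can be read off from bounds on x. *)
  pose d := Num.min e pi / 2.
  have d0 : 0 < d by rewrite divr_gt0// lt_min e0 pi0.
  have [me mpi] : Num.min e pi <= e /\ Num.min e pi <= pi.
    by rewrite !ge_min !lexx orbT.
  have [de dpi] : d < e /\ d < pi by split; rewrite /d in d0 *; lra.
  have cd : -1 < cos (pi - d).
    by rewrite -(@cospi R) lt_cos; lra.
  near=> x.
  have x1 : -1 < x by near: x; exact: nbhs_right_gt.
  have xc : x < cos (pi - d) by near: x; exact: nbhs_right_lt.
  have x11 : x <= 1 by rewrite (le_trans (ltW xc))// cos_le1.
  have xb : -1 <= x <= 1 by rewrite ltW.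
  have ax := acos_ge0 xb; have axp := acos_lepi xb.
  rewrite ger0_norm ?subr_ge0//; suff : pi - d < acos x by lra.
  rewrite -lt_cos ?ax ?axp ?acosK ?in_itv//; lra.
- rewrite acos1; apply/cvgrPdist_lt => e e0.
  pose d := Num.min e pi / 2.
  have d0 : 0 < d by rewrite divr_gt0// lt_min e0 pi0.
  have [me mpi] : Num.min e pi <= e /\ Num.min e pi <= pi.
    by rewrite !ge_min !lexx orbT.
  have [de dpi] : d < e /\ d < pi by split; rewrite /d in d0 *; lra.
  have cd : cos d < 1.
    by rewrite -(@cos0 R) lt_cos; lra.
  near=> x.
  have x1 : x < 1 by near: x; exact: nbhs_left_lt.
  have xc : cos d < x by near: x; exact: nbhs_left_gt.
  have x11 : -1 <= x by rewrite (le_trans _ (ltW xc))// cos_geN1.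
  have xb : -1 <= x <= 1 by rewrite x11 ltW.
  have ax := acos_ge0 xb; have axp := acos_lepi xb.
  rewrite sub0r normrN ger0_norm//; suff : acos x < d by lra.
  rewrite -lt_cos ?ax ?axp ?acosK ?in_itv//; lra.
Unshelve. all: by end_near. Qed.

(** With s = sin (pi / 6), the triple angle formula at pi / 2 reads (s + 1) (2 s - 1)^2 = 0, and s >
    0. *)
Lemma sin_pi6 : sin (pi / 6) = 2^-1.
Proof.
have pi0 := @pi_gt0 R.
pose y := pi / 6; rewrite -/y.
have s0 : 0 < sin y by apply: sin_gt0_pi; apply/andP; split; rewrite /y; lra.
have : sin (y + (y + y)) = 1.
  by rewrite -(@sin_pihalf R); congr sin; rewrite /y; field.
rewrite !sinD !cosD.
have := cos2Dsin2 y; move: (cos y) (sin y) s0 => c s s0 cs e.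
have : (s + 1) * (2 * s - 1) ^+ 2 = 0.
  have c2 : c * c = 1 - s * s by rewrite -cs; ring.
  have : s * (c * c - s * s) + c * (s * c + c * s) = 1 by [].
  have -> : s * (c * c - s * s) + c * (s * c + c * s) = 3 * s * (c * c) - s * s * s by ring.
  rewrite c2 => h.
  have -> : (s + 1) * (2 * s - 1) ^+ 2 =
    1 - (3 * s * (1 - s * s) - s * s * s) by ring.
  by rewrite h subrr.
move/eqP; rewrite mulf_eq0 => /orP[/eqP|]; first by lra.
by rewrite sqrf_eq0 => /eqP; lra.
Qed.

Lemma cos_pi6 : cos (pi / 6) = Num.sqrt 3 / 2.
Proof.
have pi0 := @pi_gt0 R.
have c0 : 0 <= cos (pi / 6) by apply: cos_ge0_pihalf; apply/andP; split; lra.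
have d0 : 0 <= Num.sqrt 3 / 2 :> R by rewrite divr_ge0// sqrtr_ge0.
apply/eqP; rewrite -(eqrXn2 (isT : (0 < 2)%N) c0 d0).
by rewrite cos2sin2 sin_pi6 expr_div_n sqr_sqrtr//; apply/eqP; field.
Qed.

Lemma ge0_derive_le (f g f' g' : R -> R) : f 0 = g 0 ->
  (forall x : R, is_derive x 1 f (f' x)) -> (forall x : R, is_derive x 1 g (g' x)) ->
  (forall x, 0 <= x -> f' x <= g' x) -> forall x, 0 <= x -> f x <= g x.
Proof.
move=> fg0 df dg fg' x; rewrite le_eqVlt => /predU1P[<-|x0]; first by rewrite fg0.
have dgf (y : R) : is_derive y 1 (g - f) (g' y - f' y) by exact: is_deriveB.
have gf0 : (g - f) 0 = 0 by rewrite -[LHS]/(g 0 - f 0) fg0 subrr.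
rewrite -subr_ge0 -gf0 -[leRHS]/((g - f) x).
apply: (@ger0_derive1_le R (g - f) 0 x _ _ true false) => //.
- by move=> y; rewrite in_itv/= => /andP[y0 _]; rewrite derive1E derive_val subr_ge0 fg'// ltW.
- apply: continuous_subspaceT => y; apply: differentiable_continuous.
  by apply/derivable1_diffP; exact: ex_derive.
- by rewrite in_itv/= lexx ltW.
- by rewrite in_itv/= lexx ltW.
- exact: ltW.
Qed.

(** Starting from cos <= 1, repeated comparison of derivatives bounds sin and cos by their Taylor
    polynomials, alternately from above and below. *)
Lemma sin_le_taylor5 (x : R) : 0 <= x -> sin x <= x - x ^+ 3 / 6 + x ^+ 5 / 120.
Proof.
have dp (p : {poly R}) (y d : R) : p^`().[y] = d -> is_derive y 1 (horner p) d.
  by move=> <-; exact: is_derive_poly.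
pose p1 : {poly R} := 'X.
pose p2 : {poly R} := (- 2^-1) *: 'X^2 + 1%:P.
pose p3 : {poly R} := (- 6^-1) *: 'X^3 + 'X.
pose p4 : {poly R} := 24^-1 *: 'X^4 + (- 2^-1) *: 'X^2 + 1%:P.
pose p5 : {poly R} := 120^-1 *: 'X^5 + (- 6^-1) *: 'X^3 + 'X.
have d1 (y : R) : is_derive y 1 (horner p1) 1 by apply: dp; rewrite derivX hornerC.
have dE := (derivD, derivZ, derivXn, derivX, derivC).
have d2 (y : R) : is_derive y 1 (horner p2) (- p1.[y]).
  by apply: dp; rewrite !dE !hornerE/= ?hornerMn ?hornerXn; field.
have d3 (y : R) : is_derive y 1 (horner p3) p2.[y].
  by apply: dp; rewrite !dE !hornerE/= ?hornerMn ?hornerXn; field.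
have d4 (y : R) : is_derive y 1 (horner p4) (- p3.[y]).
  by apply: dp; rewrite !dE !hornerE/= ?hornerMn ?hornerXn; field.
have d5 (y : R) : is_derive y 1 (horner p5) p4.[y].
  by apply: dp; rewrite !dE !hornerE/= ?hornerMn ?hornerXn; field.
have s1 y : 0 <= y -> sin y <= p1.[y].
  apply: (@ge0_derive_le sin (horner p1) cos (fun=> 1)) => //.
  by rewrite sin0 hornerX.
have s2 y : 0 <= y -> p2.[y] <= cos y.
  apply: (@ge0_derive_le (horner p2) cos (fun y => - p1.[y]) (fun y => - sin y)) => //.
    by rewrite cos0 !hornerE/=; lra.
  by move=> z z0; rewrite lerN2 s1.
have s3 y : 0 <= y -> p3.[y] <= sin y.
  apply: (@ge0_derive_le (horner p3) sin (horner p2) cos) => //.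
  by rewrite sin0 !hornerE/=; lra.
have s4 y : 0 <= y -> cos y <= p4.[y].
  apply: (@ge0_derive_le cos (horner p4) (fun y => - sin y) (fun y => - p3.[y])) => //.
    by rewrite cos0 !hornerE/=; lra.
  by move=> z z0; rewrite lerN2 s3.
have s5 y : 0 <= y -> sin y <= p5.[y].
  apply: (@ge0_derive_le sin (horner p5) cos (horner p4)) => //.
  by rewrite sin0 !hornerE/=; lra.
move=> x0; apply: (le_trans (s5 x x0)); rewrite !hornerE/=; lra.
Qed.

(** The bound is 6 * 0.52358 = 3.14148. Were pi / 6 at most b = 0.52358, then 1/2 = sin (pi / 6) <=
    sin b, while the Taylor bound at b is below 1/2. *)
Lemma pi_gt : 6 * (52 / 100 + 35 / 100 ^+ 2 + 8 / (10 * 100 ^+ 2)) < pi.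
Proof.
rewrite ltNge; apply/negP => pile; have pi0 := @pi_gt0 R.
pose b : R := 52 / 100 + 35 / 100 ^+ 2 + 8 / (10 * 100 ^+ 2).
have yb : pi / 6 <= b by rewrite /b; lra.
have b0 : 0 <= b by rewrite /b; lra.
have : sin (pi / 6) <= sin b.
  rewrite leNgt ltr_sin ?in_itv/= -?leNgt//; first by have := @pihalf_ge1 R; rewrite /b; lra.
  lra.
have := sin_le_taylor5 b0; rewrite sin_pi6 /b; lra.
Qed.

(** The right-hand side of [acos_support] at c = cos t. Its derivative sin t (2 sin t - 1) changes
    sign at pi / 6, which is therefore the minimum on [0, pi / 2]. *)
Let h (t : R) := t - sin t * cos t + cos t.

Let dh (t : R) : is_derive t 1 h (sin t * (2 * sin t - 1)).
Proof.
have d : is_derive t 1 (id - sin * cos + cos)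
  (1 - (sin t *: - sin t + cos t *: cos t) - sin t) by exact: is_deriveD.
apply: (is_derive_eq d).
rewrite /GRing.scale/=.
have := cos2Dsin2 t.
rewrite !expr2 => /(canRL (addrK _)) ->; ring.
Qed.

Let h_min (t : R) : 0 <= t <= pi / 2 -> h (pi / 6) <= h t.
Proof.
move=> /andP[t0 t2]; have pi0 := @pi_gt0 R.
have ch (a b : R) : {within `[a, b], continuous h}.
  apply: continuous_subspaceT => y; apply: differentiable_continuous.
  by apply/derivable1_diffP; exact: ex_derive.
have sin_mono x y : - (pi / 2) <= x -> x < y -> y <= pi / 2 -> sin x < sin y.
  by move=> x2 xy y2; rewrite ltr_sin ?in_itv//=; apply/andP; split; lra.
have dhE y : (h^`() y)%classic = sin y * (2 * sin y - 1).
  by rewrite derive1E; have [] := dh y.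
have [t6|t6] := leP t (pi / 6).
  apply: (@ler0_derive1_le R h 0 (pi / 6) _ _ true false) => //.
  - move=> y; rewrite in_itv/= => /andP[y0 y6]; rewrite dhE.
    have : 0 < sin y by apply: sin_gt0_pi; apply/andP; split; lra.
    have : sin y < sin (pi / 6) by apply: sin_mono; lra.
    by rewrite sin_pi6 => s1 s2; apply: mulr_ge0_le0; lra.
  - by rewrite in_itv/=; apply/andP; split; lra.
  - by rewrite in_itv/=; apply/andP; split; lra.
apply: (@ger0_derive1_le R h (pi / 6) (pi / 2) _ _ true false) => //.
- move=> y; rewrite in_itv/= => /andP[y0 y6]; rewrite dhE.
  have : sin (pi / 6) < sin y by apply: sin_mono; lra.
  by rewrite sin_pi6 => s1; apply: mulr_ge0; lra.
- by rewrite in_itv/=; apply/andP; split; lra.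
- by rewrite in_itv/=; apply/andP; split; lra.
- exact: ltW.
Qed.

(** The circular segment area acos c - c sqrt (1 - c^2) stays above its tangent at c = sqrt 3 / 2,
    whose slope is -1. *)
Lemma acos_support (c : R) : 0 <= c <= 1 ->
  pi / 6 + Num.sqrt 3 / 4 <= acos c - c * Num.sqrt (1 - c ^+ 2) + c.
Proof.
move=> /andP[c0 c1]; have pi0 := @pi_gt0 R.
have cb : -1 <= c <= 1 by rewrite c1 andbT; lra.
have a2 : acos c <= pi / 2.
  rewrite leNgt; apply/negP => ac.
  have : cos (acos c) < cos (pi / 2) by rewrite lt_cos ?acos_ge0 ?acos_lepi//; lra.
  by rewrite acosK ?in_itv// cos_pihalf; lra.
have := @h_min (acos c); rewrite acos_ge0// a2 => /(_ isT).
by rewrite /h sin_acos// acosK ?in_itv// sin_pi6 cos_pi6; lra.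
Qed.

End trigonometry.

(** * Explicit ball and cone volumes in dimensions 4 and 5 *)

Section cap_volumes.
Context {R : realType}.
Local Notation a := (Num.sqrt 3 / 2 : R).

Let s (x : R) := Num.sqrt (1 - x ^+ 2).

Let ds (x : R) : -1 < x < 1 -> is_derive x 1 s (- x / s x).
Proof.
move=> /andP[x1 x2]; have sx0 : 0 < 1 - x ^+ 2 by nra.
have s0 : s x != 0 by rewrite gt_eqF// sqrtr_gt0.
pose q : {poly R} := 1%:P - 'X^2.
have qE y : q.[y] = 1 - y ^+ 2 by rewrite !hornerE.
have dq : is_derive x 1 (horner q) (- (2 * x)).
  apply: (is_derive_eq (is_derive_poly q x)).
  by rewrite !(derivD, derivN, derivC, derivXn) !hornerE/=; ring.
have dsq : is_derive q.[x] 1 Num.sqrt (2 * Num.sqrt q.[x])^-1.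
  by apply: is_derive1_sqrt; rewrite qE.
have -> : s = Num.sqrt \o horner q by apply/funext => y; rewrite /= qE.
apply: (is_derive_eq (is_derive1_comp dsq dq)).
by rewrite /= qE -/(s x); field.
Qed.

(** The primitive of (1 - x^2)^(3/2) given by the reduction formula for powers of sqrt (1 - x^2),
    with -acos in place of arcsin. *)
Let P4 (x : R) := 3 / 8 * (x * s x - acos x) + x * s x ^+ 3 / 4.

Let dP4 (x : R) : -1 < x < 1 -> is_derive x 1 P4 (s x ^+ 3).
Proof.
move=> xb; have dsx := ds xb; have dax := is_derive1_acos xb.
have sx0 : 0 < 1 - x ^+ 2 by case/andP: xb => *; nra.
have s0 : s x != 0 by rewrite gt_eqF// sqrtr_gt0.
have s2 : s x ^+ 2 = 1 - x ^+ 2 by rewrite sqr_sqrtr// ltW.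
have d1 : is_derive x 1 (id * s) (x *: (- x / s x) + s x *: 1) by exact: is_deriveM.
have d2 : is_derive x 1 (s ^+ 3) ((3%:R * s x ^+ 2) *: (- x / s x)) by exact: is_deriveX.
have d3 : is_derive x 1 (id * s ^+ 3)
  (x *: ((3%:R * s x ^+ 2) *: (- x / s x)) + (s x ^+ 3) *: 1) by exact: is_deriveM.
have -> : P4 = (3 / 8) \*: (id * s - @acos R) + 4^-1 \*: (id * s ^+ 3).
  by apply/funext => y; rewrite /P4/= !fctE /GRing.scale/= (mulrC _ 4^-1).
have d4 : is_derive x 1 ((3 / 8) \*: (id * s - @acos R) + 4^-1 \*: (id * s ^+ 3))
  ((3 / 8) *: (x *: (- x / s x) + s x *: 1 - - (s x)^-1) +
   4^-1 *: (x *: ((3%:R * s x ^+ 2) *: (- x / s x)) + (s x ^+ 3) *: 1)).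
  apply: is_deriveD; apply: is_deriveZ => //; exact: is_deriveB.
apply: (is_derive_eq d4); rewrite /GRing.scale/=.
have -> : 3 / 8 * (x * (- x / s x) + s x * 1 - - (s x)^-1) +
  4^-1 * (x * (3 * s x ^+ 2 * (- x / s x)) + s x ^+ 3 * 1) =
  3 / 8 * (s x + (1 - x ^+ 2) / s x) - 3 / 4 * x ^+ 2 * s x + s x ^+ 3 / 4.
  by field.
have -> : x ^+ 2 = 1 - s x ^+ 2 by rewrite s2; ring.
by field.
Qed.

Let cP4 : {within `[(-1)%R, 1%R], continuous P4}.
Proof.
have cs : {within `[(-1)%R, 1%R], continuous s}.
  apply: continuous_subspaceT => x; have := @continuous_sqrt1Bsqr R 1 x.
  by rewrite (_ : (fun x : R => _) = s)//; apply/funext => y; rewrite expr1.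
have cid : {within `[(-1)%R, 1%R], continuous (@id R)}.
  by apply: continuous_subspaceT => x; exact: cvg_id.
have ca := @acos_within_continuous R.
have cs3 : {within `[(-1)%R, 1%R], continuous (fun x => s x ^+ 3)}.
  by apply: continuous_subspaceT; exact: continuous_sqrt1Bsqr.
move=> x; apply: cvgD.
  apply: cvgM; first exact: cvg_cst.
  by apply: cvgB; [apply: cvgM; [exact: cid|exact: cs]|exact: ca].
apply: cvgM; last exact: cvg_cst.
apply: cvgM; first exact: cid.
exact: cs3.
Qed.

Lemma ball_vol4 :
  em_mu (euclidean_space R 4) (em_ball 1) = (unit_ball_vol 3 * (3 / 8 * pi))%:E.
Proof.
rewrite (ball_vol_primitive (k := 3) isT cP4 dP4); congr (_ * _)%:E.
have s1 : s 1 = 0 by rewrite /s expr1n subrr sqrtr0.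
have sN1 : s (-1) = 0 by rewrite /s sqrrN expr1n subrr sqrtr0.
by rewrite /P4 s1 sN1 acos1 acosN1; field.
Qed.

(* The lower bounds in cone_vol4 and cone_vol5 are the tangents at
   c = sqrt 3 / 2 of the convex functions giving the volume of the cone; they are
   negative for c >= 1, where the cone is empty. *)
Lemma cone_vol4 (u : 'rV[R]_4) (c : R) : dotv u u = 1 -> 0 < c ->
  ((unit_ball_vol 3 * (3 / 8 * (pi / 6 - Num.sqrt 3 / 4 - (c - a))))%:E <=
   em_mu (euclidean_space R 4) (cone u c))%E.
Proof.
move=> u1 c0; have kp := unit_ball_vol_gt0 (R := R) 3.
have [c1|c1] := ltP c 1; last first.
  apply: (@le_trans _ _ 0%E); last exact: measure_ge0.
  rewrite lee_fin; apply: mulr_ge0_le0; first exact: ltW.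
  (* At c = 1 the support inequality says that the tangent is at most 0, and the tangent decreases
     in c. *)
  have := @acos_support R 1; rewrite ler01 lexx => /(_ isT).
  by rewrite acos1 expr1n subrr sqrtr0; lra.
apply: le_trans (cone_vol_primitive (k := 3) isT cP4 dP4 u1 _); last by rewrite c0.
rewrite lee_fin; apply: ler_wpM2l; first exact: ltW.
have c01 : 0 <= c <= 1 by rewrite !ltW.
(* The terms c s(c)^3 / 4 cancel in the bound of [cone_vol_primitive], which leaves 3/8 (acos c - c
   s(c)). *)
have := acos_support c01; rewrite -/(s c).
have s1 : s 1 = 0 by rewrite /s expr1n subrr sqrtr0.
rewrite /P4 s1 acos1 -/(s c); lra.
Qed.

Let sqrtX4 (x : R) : 0 <= x -> Num.sqrt x ^+ 4 = x ^+ 2.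
Proof. by move=> x0; rewrite (_ : 4%N = (2 * 2)%N)// exprM sqr_sqrtr. Qed.

Let P5 : {poly R} := 'X - (2 / 3) *: 'X^3 + 5^-1 *: 'X^5.

Let dP5 (x : R) : -1 < x < 1 -> is_derive x 1 (horner P5) (Num.sqrt (1 - x ^+ 2) ^+ 4).
Proof.
move=> /andP[x1 x2]; apply: (is_derive_eq (is_derive_poly P5 x)).
rewrite sqrtX4; last by nra.
by rewrite !(derivD, derivN, derivZ, derivXn, derivX) !hornerE/= ?hornerMn ?hornerXn; field.
Qed.

Let cP5 : {within `[(-1)%R, 1%R], continuous (horner P5)}.
Proof. by apply: continuous_subspaceT; exact: continuous_horner. Qed.

Lemma ball_vol5 :
  em_mu (euclidean_space R 5) (em_ball 1) = (unit_ball_vol 4 * (16 / 15))%:E.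
Proof.
rewrite (ball_vol_primitive (k := 4) isT cP5 dP5); congr (_ * _)%:E.
by rewrite !hornerE/=; field.
Qed.

Lemma cone_vol5 (u : 'rV[R]_5) (c : R) : dotv u u = 1 -> 0 < c ->
  ((unit_ball_vol 4 * (4 / 15 * (2 - 3 * a + a ^+ 3) - 5^-1 * (c - a)))%:E <=
   em_mu (euclidean_space R 5) (cone u c))%E.
Proof.
move=> u1 c0.
have a0 : 0 <= a by rewrite divr_ge0// sqrtr_ge0.
have a2 : a ^+ 2 = 3 / 4 by rewrite expr_div_n sqr_sqrtr//; field.
have a1 : a < 1 by nra.
have a3 : a ^+ 3 = 3 / 4 * a by rewrite exprSr a2.
have kp := unit_ball_vol_gt0 (R := R) 4.
move: a a0 a2 a1 a3 => b b0 b2 b1 b3.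
have [c1|c1] := ltP c 1; last first.
  apply: (@le_trans _ _ 0%E); last exact: measure_ge0.
  by rewrite lee_fin; apply: mulr_ge0_le0; [exact: ltW|nra].
apply: le_trans (cone_vol_primitive (k := 4) isT cP5 dP5 u1 _); last by rewrite c0.
rewrite lee_fin; apply: ler_wpM2l; first exact: ltW.
rewrite sqrtX4; last by nra.
rewrite !hornerE/=.
(* The bound of [cone_vol_primitive] simplifies to 4/15 (2 - 3 c + c^3); it exceeds its tangent at b
   by 4/15 (c - b)^2 (c + 2 b). *)
have : 0 <= (c - b) ^+ 2 * (c + 2 * b) by apply: mulr_ge0; [exact: sqr_ge0|lra].
have -> : (c - b) ^+ 2 * (c + 2 * b) = c ^+ 3 - 3 * b ^+ 2 * c + 2 * b ^+ 3 by ring.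
rewrite b2 b3; lra.
Qed.

End cap_volumes.

(** * Contact graphs *)

Section euclidean_geometry.
Context {R : realType} {d : nat}.
Implicit Types (x y z u v : 'rV[R]_d).

Lemma dotvDl x y z : dotv (x + y) z = dotv x z + dotv y z.
Proof. by rewrite /dotv -big_split; apply: eq_bigr => i _; rewrite mxE mulrDl. Qed.

Lemma dotvNl x z : dotv (- x) z = - dotv x z.
Proof. by rewrite -scaleN1r dotvZl mulN1r. Qed.

Lemma dotvv_lin (a b : R) x y : dotv (a *: x + b *: y) (a *: x + b *: y) =
  a ^+ 2 * dotv x x + 2 * a * b * dotv x y + b ^+ 2 * dotv y y.
Proof.
rewrite dotvDl !dotvZl !(dotvC _ (_ + _)) !dotvDl !dotvZl (dotvC y x); ring.
Qed.

Lemma eucl_dist_dotv x y : eucl_dist x y = Num.sqrt (dotv (x - y) (x - y)).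
Proof.
congr Num.sqrt; apply: eq_bigr => i _; by rewrite !mxE expr2.
Qed.

Lemma eucl_dist_sqr x y : eucl_dist x y ^+ 2 = dotv (x - y) (x - y).
Proof. by rewrite eucl_dist_dotv sqr_sqrtr// dotvv_ge0. Qed.

Lemma continuous_eucl_dist x : continuous (eucl_dist x).
Proof.
move=> y; apply: (@continuous_comp _ _ _
  (fun y => \sum_(i < d) (x ord0 i - y ord0 i) ^+ 2) Num.sqrt); last exact: sqrt_continuous.
have cadd : continuous (fun z : R * R => z.1 + z.2) by exact: add_continuous.
have ci i : continuous (fun y : 'rV[R]_d => (x ord0 i - y ord0 i) ^+ 2).
  move=> z.
  apply: (@continuous_comp _ _ _ (fun y => x ord0 i - y ord0 i) (fun t : R => t ^+ 2)).
    exact: (cvgB (cvg_cst (x ord0 i)) (@coord_continuous R 1 d ord0 i z)).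
  exact: exprn_continuous.
exact: (@continuous_big R 'I_d +%R 0 xpredT cadd _ (index_enum _)
  (fun i y => (x ord0 i - y ord0 i) ^+ 2) (fun i _ => ci i)).
Qed.

(** Euclidean distance is continuous for the topology of the sup norm, so the strict inequality
    persists near y. *)
Lemma interior_eucl_closed_ball x y (r : R) :
  eucl_dist x y < r -> interior (eucl_closed_ball x r) y.
Proof.
move=> xyr; rewrite /interior.
have : \forall z \near y, eucl_dist x z < r.
  exact: (cvgr_lt (eucl_dist x y) (@continuous_eucl_dist x y) r xyr).
by apply: filterS => z; exact: ltW.
Qed.

Lemma eucl_dist_lt x y (r : R) : 0 < r ->
  dotv (y - x) (y - x) < r ^+ 2 -> eucl_dist x y < r.
Proof.
move=> r0 h; rewrite eucl_dist_dotv -(gtr0_norm r0) -sqrtr_sqr ltr_sqrt ?exprn_gt0//.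
by rewrite -opprB dotvNl dotvC dotvNl opprK.
Qed.

End euclidean_geometry.

(** * Tangent balls and their cones *)

Section packing.
Context {R : realType} {k n : nat}.
Variables (c : 'I_n -> 'rV[R]_k.+1) (r : 'I_n -> R).
Hypothesis packing : is_packing c r.

Let r_gt0 i : 0 < r i. Proof. by case: packing. Qed.

Let disjoint_balls i j z : i != j ->
  eucl_dist (c i) z < r i -> eucl_dist (c j) z < r j -> False.
Proof.
move=> ij zi zj; have [_ _ /(_ i j ij)] := packing.
by move/seteqP => [/(_ z) + _]; apply; split; exact: interior_eucl_closed_ball.
Qed.

Definition adjacent (i j : 'I_n) : bool := `[< i != j /\
  tangent (eucl_closed_ball (c i) (r i)) (eucl_closed_ball (c j) (r j)) >].

Lemma adjacent_sym i j : adjacent i j -> adjacent j i.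
Proof.
move=> /asboolP[ij [x tx]]; apply/asboolP; split; first by rewrite eq_sym.
by exists x; rewrite setIC.
Qed.

(** A common point gives one inequality by the triangle inequality. If the centres were closer than
    r i + r j, the point dividing their segment in the ratio r i : r j would be interior to both
    balls. *)
Lemma adjacent_dist i j : adjacent i j ->
  dotv (c j - c i) (c j - c i) = (r i + r j) ^+ 2.
Proof.
move=> /asboolP[ij [x /seteqP[_ /(_ x erefl)[]]]]; rewrite /eucl_closed_ball/= => xi xj.
have [ri rj] := (r_gt0 i, r_gt0 j).
have rij : r i + r j != 0 by rewrite gt_eqF// addr_gt0.
apply/le_anti/andP; split.
  have sq_le p (q : R) : 0 < q -> eucl_dist p x <= q -> dotv (p - x) (p - x) <= q ^+ 2.
    by move=> q0 pq; rewrite -eucl_dist_sqr ler_sqr ?nnegrE ?sqrtr_ge0// ltW.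
  have pi := sq_le _ _ ri xi; have pj := sq_le _ _ rj xj.
  (* With this square, |c i - x| <= r i and |c j - x| <= r j give <c i - x, c j - x> >= - r i r j,
     hence the triangle inequality without square roots. *)
  have := dotvv_ge0 (r j *: (c i - x) + r i *: (c j - x)).
  rewrite dotvv_lin.
  have -> : c j - c i = 1 *: (c j - x) + (-1) *: (c i - x).
    by rewrite scale1r scaleN1r opprB addrA subrK.
  rewrite dotvv_lin (dotvC (c j - x) (c i - x)).
  move: pi pj; move: (dotv (c i - x) (c i - x)) (dotv (c j - x) (c j - x))
    (dotv (c i - x) (c j - x)) => p q s pi pj h.
  have rr0 : 0 < r i * r j by exact: mulr_gt0.
  have h1 : 0 <= r j ^+ 2 * (r i ^+ 2 - p) by rewrite mulr_ge0 ?sqr_ge0// subr_ge0.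
  have h2 : 0 <= r i ^+ 2 * (r j ^+ 2 - q) by rewrite mulr_ge0 ?sqr_ge0// subr_ge0.
  have h3 : 0 <= (r i * r j) * (2 * (r i * r j) + 2 * s).
    have -> : (r i * r j) * (2 * (r i * r j) + 2 * s) =
      r j ^+ 2 * (r i ^+ 2 - p) + r i ^+ 2 * (r j ^+ 2 - q) +
      (r j ^+ 2 * p + 2 * r j * r i * s + r i ^+ 2 * q) by ring.
    by apply: addr_ge0 => //; exact: addr_ge0.
  rewrite pmulr_rge0// in h3; lra.
rewrite leNgt; apply/negP => lt.
pose t := r i / (r i + r j).
have t0 : 0 < t by apply: divr_gt0 => //; exact: addr_gt0.
have t1 : 0 < r j / (r i + r j) by apply: divr_gt0 => //; exact: addr_gt0.
apply: (@disjoint_balls i j (c i + t *: (c j - c i)) ij); apply: eucl_dist_lt => //.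
  rewrite addrC addKr dotvZl dotvC dotvZl mulrA -expr2.
  rewrite -[ltRHS](divfK (expf_neq0 2 rij)) -expr_div_n -/t.
  by rewrite ltr_pM2l// exprn_gt0.
have -> : c i + t *: (c j - c i) - c j = (t - 1) *: (c j - c i).
  by apply/rowP => l; rewrite !mxE; ring.
rewrite dotvZl dotvC dotvZl mulrA -expr2.
have -> : (t - 1) ^+ 2 = (r j / (r i + r j)) ^+ 2 by rewrite /t; field.
rewrite -[ltRHS](divfK (expf_neq0 2 rij)) -expr_div_n.
by rewrite ltr_pM2l// exprn_gt0.
Qed.

(** The law of cosines in the triangle with sides sqrt 3 r_i, r_i + r_j and r_j. The value may
    exceed 1; then ball j does not reach the sphere. *)
Definition cap_cos (i j : 'I_n) : R := (2 * r i + r j) / (Num.sqrt 3 * (r i + r j)).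

Lemma cap_cos_gt0 i j : 0 < cap_cos i j.
Proof.
have [ri rj] := (r_gt0 i, r_gt0 j).
apply: divr_gt0; first by rewrite addr_gt0// mulr_gt0.
by rewrite mulr_gt0 ?sqrtr_gt0// addr_gt0.
Qed.

(** The numerators add up to 3 (r_i + r_j). With spheres of radius q r_i the sum would be (q^2 + 3)
    / (2 q), also free of the radii; q = sqrt 3 minimises it and so gives the largest caps. *)
Lemma cap_cos_sum i j : cap_cos i j + cap_cos j i = Num.sqrt 3.
Proof.
have [ri rj] := (r_gt0 i, r_gt0 j).
have s3 : Num.sqrt 3 ^+ 2 = 3 :> R by rewrite sqr_sqrtr.
have s0 : Num.sqrt 3 != 0 :> R by rewrite gt_eqF// sqrtr_gt0.
have rij : r i + r j != 0 by rewrite gt_eqF// addr_gt0.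
have -> : cap_cos i j + cap_cos j i = 3 / Num.sqrt 3.
  by rewrite /cap_cos (addrC (r j)); field; rewrite rij s0.
by rewrite -[X in X / _]s3 expr2 mulfK.
Qed.

(** Divided by r i + r j, which is the distance of the centres when the balls are tangent. *)
Definition direction (i j : 'I_n) : 'rV[R]_k.+1 := (r i + r j)^-1 *: (c j - c i).

Lemma direction_unit i j : adjacent i j -> dotv (direction i j) (direction i j) = 1.
Proof.
move=> /adjacent_dist e; have [ri rj] := (r_gt0 i, r_gt0 j).
rewrite /direction dotvZl dotvC dotvZl e; field.
by rewrite gt_eqF// addr_gt0.
Qed.

(* The cone over the cap cut by ball j out of the sphere of radius sqrt 3 * r i
   around c i: the radial projection of its points to that sphere lies in the
   interior of ball j. *)
Definition neighbour_cone (i j : 'I_n) : set (em_T (euclidean_space R k.+1)) :=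
  cone (direction i j) (cap_cos i j).

Lemma neighbour_cone_ball i j z : adjacent i j -> neighbour_cone i j z ->
  eucl_dist (c j) (c i + (Num.sqrt 3 * r i / Num.sqrt (dotv (em_vec z) (em_vec z)))
    *: em_vec z) < r j.
Proof.
move=> aij []; have [ri rj] := (r_gt0 i, r_gt0 j).
have cc := cap_cos_gt0 i j; have u1 := direction_unit aij.
move: (em_vec z) => x; set u := direction i j in u1 *; set N := dotv x x => ux0 cN _.
have rij : r i + r j != 0 by rewrite gt_eqF// addr_gt0.
have N0 : 0 < N.
  rewrite lt_neqAle dotvv_ge0 andbT eq_sym; apply/eqP => N0.
  by move: ux0; rewrite dotvC (dotv0l_sqr0 u N0) ltxx.
have s0 : 0 < Num.sqrt N by rewrite sqrtr_gt0.
have s2 : Num.sqrt N ^+ 2 = N by rewrite sqr_sqrtr// ltW.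
have q0 : 0 < Num.sqrt 3 :> R by rewrite sqrtr_gt0.
have q2 : Num.sqrt 3 ^+ 2 = 3 :> R by rewrite sqr_sqrtr.
have us : cap_cos i j * Num.sqrt N < dotv u x.
  have : (cap_cos i j * Num.sqrt N) ^+ 2 < dotv u x ^+ 2 by rewrite exprMn s2.
  by rewrite ltr_sqr// nnegrE; [apply: mulr_ge0; exact: ltW|exact: ltW].
apply: eucl_dist_lt => //; set l := _ / _.
have -> : c i + l *: x - c j = l *: x + (- (r i + r j)) *: u.
  by rewrite /u /direction scalerA mulNr divff// scaleN1r opprB addrAC addrA addrC addrA.
rewrite dotvv_lin u1 -/N (dotvC x u).
have lN : l ^+ 2 * N = 3 * r i ^+ 2.
  by rewrite /l expr_div_n exprMn q2 s2 mulfVK// gt_eqF.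
have l0 : 0 < l by rewrite divr_gt0// mulr_gt0.
(* A point with cosine exactly [cap_cos i j] would be at distance r_j from c j, since 3 r_i^2 - 2
   r_i (2 r_i + r_j) + (r_i + r_j)^2 = r_j^2; a larger cosine brings it closer. *)
have lc : l * (cap_cos i j * Num.sqrt N) * (r i + r j) = r i * (2 * r i + r j).
  by rewrite /l /cap_cos; field; rewrite !gt_eqF// addr_gt0.
have : l * (cap_cos i j * Num.sqrt N) * (r i + r j) < l * dotv u x * (r i + r j).
  by rewrite ltr_pM2r ?addr_gt0// ltr_pM2l.
rewrite lc lN; lra.
Qed.

(** The projection to the sphere of a common point of two cones would be interior to two different
    balls. *)
Lemma trivIset_neighbour_cone i : trivIset (adjacent i) (neighbour_cone i).
Proof.
move=> j l aj al [z [zj zl]]; apply/eqP/negPn/negP => jl.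
exact: (disjoint_balls jl (neighbour_cone_ball aj zj) (neighbour_cone_ball al zl)).
Qed.

Lemma neighbour_cone_vol i : (\sum_(j < n | adjacent i j)
    em_mu (euclidean_space R k.+1) (neighbour_cone i j) <=
  em_mu (euclidean_space R k.+1) (em_ball 1))%E.
Proof.
have mc j : measurable (neighbour_cone i j) by exact: measurable_cone.
rewrite -measure_bigsetU_ord_cond//; last exact: trivIset_neighbour_cone.
apply: le_measure; rewrite ?inE.
- by apply: bigsetU_measurable => j _.
- exact: measurable_em_ball.
- elim/big_ind: _ => //; first by move=> A B A1 B1; rewrite subUset.
  by move=> j _ z [].
Qed.

(** Exchanging i and j turns the sum into its negative, as adjacency is symmetric. *)
Lemma adjacent_sum0 (f : 'I_n -> 'I_n -> R) :
  (forall i j, adjacent i j -> f i j + f j i = 0) ->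
  \sum_i \sum_(j | adjacent i j) f i j = 0.
Proof.
move=> f0; set S := LHS.
have SC : S = \sum_i \sum_(j | adjacent i j) f j i.
  rewrite /S (exchange_big_dep xpredT)//=; apply: eq_bigr => i _; apply: eq_bigl => j.
  by apply/idP/idP; exact: adjacent_sym.
have : S + S = 0.
  rewrite {2}SC -big_split big1//= => i _; rewrite -big_split big1//= => j; exact: f0.
lra.
Qed.

(** Every edge comes from a pair of A, and A and its mirror image B are disjoint sets of ordered
    adjacent pairs. *)
Lemma card_contact_edges :
  (#|contact_edges c r|.*2 <= \sum_(i < n) \sum_(j < n | adjacent i j) 1)%N.
Proof.
pose A := [set p : 'I_n * 'I_n | adjacent p.1 p.2 && (p.1 < p.2)%N]%SET.
pose B := [set p : 'I_n * 'I_n | adjacent p.1 p.2 && (p.2 < p.1)%N]%SET.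
have EA : (#|contact_edges c r| <= #|A|)%N.
  apply: leq_trans (leq_imset_card (fun p => [set p.1; p.2]%SET) A).
  apply/subset_leq_card/fintype.subsetP => e; rewrite inE => /asboolP[i [j [ij tij ->]]].
  have aij : adjacent i j by apply/asboolP.
  have [lij|lji|eij] := ltngtP i j.
  - by apply/imsetP; exists (i, j); rewrite ?inE ?aij ?lij.
  - apply/imsetP; exists (j, i); first by rewrite inE adjacent_sym.
    by rewrite finset.setUC.
  - by move/eqP: ij; case; exact: val_inj.
have AB : #|A| = #|B|.
  have sI : injective (fun p : 'I_n * 'I_n => (p.2, p.1)) by move=> [? ?] [? ?] [-> ->].
  rewrite -(card_imset _ sI); congr #|pred_of_set _|; apply/setP => -[i j].
  apply/imsetP/idP => [[[p q]]|]; rewrite !inE /=.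
    by move=> /andP[apq pq] [-> ->]; rewrite adjacent_sym.
  move=> /andP[aij ij]; exists (j, i) => //.
  by rewrite inE/= adjacent_sym.
have AB0 : (A :&: B)%SET = finset.set0.
  by apply/setP => -[i j]; rewrite !inE/=; case: ltngtP; rewrite ?andbF.
rewrite -addnn; apply: (@leq_trans (#|A| + #|B|)); first by rewrite leq_add// -AB.
rewrite pair_big_dep/= sum1_card -cardsUI AB0 cards0 addn0.
apply/subset_leq_card/fintype.subsetP => p; rewrite !inE.
by case/orP => /andP[/asboolP].
Qed.

End packing.

(** * Summation over the packing *)

Section average_degree_bound.
Context {R : realType} {k : nat}.
(** In units of kappa, the volume of the k-dimensional unit ball in the applications, J is the
    volume of the unit ball of R^(k+1) and w - m (c - a) the tangent at a to the cone volume. The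
    number b is the bound to be proved. *)
Variables (kappa w m J b : R).
Local Notation a := (Num.sqrt 3 / 2 : R).
Hypothesis kappa_gt0 : 0 < kappa.
Hypothesis w_gt0 : 0 < w.
Hypothesis ball_vol :
  em_mu (euclidean_space R k.+1) (em_ball 1) = (kappa * J)%:E.
Hypothesis cone_vol : forall (u : 'rV[R]_k.+1) (c : R), dotv u u = 1 -> 0 < c ->
  ((kappa * (w - m * (c - a)))%:E <= em_mu (euclidean_space R k.+1) (cone u c))%E.
Hypothesis Jb : J < b * w.

(** Add up over i the inequalities saying that the cones at i fit into the unit ball. Since
    [cap_cos i j + cap_cos j i] is 2 a, the terms with m cancel, and twice the number of edges times
    w is at most n J. *)
Lemma average_degree_le n (c : 'I_n -> 'rV[R]_k.+1) (r : 'I_n -> R) :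
  is_packing c r -> average_degree R (contact_edges c r) <= J / w.
Proof.
move=> pk; have n0 : 0 < n%:R :> R by rewrite ltr0n; case: pk.
have ineq i : \sum_(j < n | adjacent c r i j) (w - m * (cap_cos r i j - a)) <= J.
  rewrite -(ler_pM2l kappa_gt0) -lee_fin -ball_vol.
  apply: le_trans (neighbour_cone_vol pk i).
  rewrite mulr_sumr -sumEFin; apply: lee_sum => j aij.
  exact: cone_vol (direction_unit pk aij) (cap_cos_gt0 pk i j).
have : \sum_(i < n) \sum_(j < n | adjacent c r i j) (w - m * (cap_cos r i j - a)) <=
    n%:R * J.
  apply: le_trans (ler_sum _ (fun i _ => ineq i)) _.
  by rewrite sumr_const card_ord mulr_natl.
have -> : \sum_(i < n) \sum_(j < n | adjacent c r i j) (w - m * (cap_cos r i j - a)) =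
    w * (\sum_(i < n) \sum_(j < n | adjacent c r i j) 1)%:R.
  have -> : w * (\sum_(i < n) \sum_(j < n | adjacent c r i j) 1)%:R =
      \sum_(i < n) \sum_(j < n | adjacent c r i j) w.
    rewrite natr_sum mulr_sumr; apply: eq_bigr => i _.
    by rewrite natr_sum mulr_sumr; apply: eq_bigr => j _; rewrite mulr1.
  apply/eqP; rewrite -subr_eq0 -sumrB; apply/eqP.
  rewrite -[RHS](@adjacent_sum0 _ _ _ c r (fun i j => - m * (cap_cos r i j - a))).
    by apply: eq_bigr => i _; rewrite -sumrB; apply: eq_bigr => j _; ring.
  by move=> i j _; rewrite -mulrDr -[RHS](mulr0 (- m)); congr (_ * _);
    have := cap_cos_sum pk i j; lra.
have : (#|contact_edges c r|.*2%:R : R) <=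
    (\sum_(i < n) \sum_(j < n | adjacent c r i j) 1)%:R.
  by rewrite ler_nat; exact: card_contact_edges.
rewrite /average_degree card_ord -muln2 natrM.
set e := #|contact_edges c r|%:R.
move: (\sum_(i < n) \sum_(j < n | adjacent c r i j) 1)%:R => s es sJ.
rewrite ler_pdivrMr// mulrAC ler_pdivlMr//.
have : w * (e * 2) <= w * s by rewrite ler_pM2l.
lra.
Qed.

Lemma sup_average_degree_lt : (sup_average_degree R k.+1 < b%:E)%E.
Proof.
apply: (@le_lt_trans _ _ (J / w)%:E); last by rewrite lte_fin ltr_pdivrMr.
apply: ub_ereal_sup => _ [n [c [r [pk ->]]]].
by rewrite lee_fin; exact: average_degree_le.
Qed.

End average_degree_bound.

Theorem corollary1 (R : realType) :
  (sup_average_degree R 4 < (34%:R + 69%:R / 100%:R : R)%R%:E)%E /\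
  (sup_average_degree R 5 < (77%:R + 76%:R / 100%:R : R)%R%:E)%E.
Proof.
have q0 : 0 <= Num.sqrt 3 :> R by exact: sqrtr_ge0.
have q2 : Num.sqrt 3 ^+ 2 = 3 :> R by rewrite sqr_sqrtr.
have q3 : Num.sqrt 3 ^+ 3 = 3 * Num.sqrt 3 :> R by rewrite exprSr q2.
(* The bound is 1.732052, against sqrt 3 = 1.7320508... *)
have qub : Num.sqrt 3 < 173 / 100 + 20 / 100 ^+ 2 + 52 / 100 ^+ 3 :> R.
  by rewrite -ltr_sqr ?nnegrE ?q2//; lra.
split.
  apply: (@sup_average_degree_lt R 3 (unit_ball_vol 3)
    (3 / 8 * (pi / 6 - Num.sqrt 3 / 4)) (3 / 8) (3 / 8 * pi)).
  - exact: unit_ball_vol_gt0.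
  - have := @pi_gt R; lra.
  - exact: ball_vol4.
  - by move=> u c u1 c0; rewrite -mulrBr; exact: cone_vol4.
  (* This amounts to pi (34.69 / 6 - 1) > 34.69 sqrt 3 / 4, which requires pi to exceed about
     3.14142; [pi_gt] gives 3.14148. *)
  - have := @pi_gt R; lra.
apply: (@sup_average_degree_lt R 4 (unit_ball_vol 4)
  (4 / 15 * (2 - 3 * (Num.sqrt 3 / 2) + (Num.sqrt 3 / 2) ^+ 3)) 5^-1 (16 / 15)).
- exact: unit_ball_vol_gt0.
- rewrite expr_div_n q3; lra.
- exact: ball_vol5.
- exact: cone_vol5.
(* Here J / w = 32 / (16 - 9 sqrt 3), so an upper bound for sqrt 3 suffices. *)
- rewrite expr_div_n q3; lra.
Qed.
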